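(* Let $R$ be a commutative noetherian local ring of depth $t$ and with residue field $k$. Then one has a filtration $$\mathrm{add}\,R=\mathrm{PD}_0^0(R)\subsetneq\mathrm{PD}_0^1(R)\subsetneq\cdots\subsetneq\mathrm{PD}_0^t(R)=\mathrm{PD}_0(R)$$ of resolving subcategories of $\mathrm{mod}\,R$, and these are all the resolving subcategories of $\mathrm{mod}\,R$ contained in $\mathrm{PD}_0(R)$. Moreover, when $t>0$, for each integer $1\le n\le t$ one has $$\mathrm{PD}_0^n(R)=\mathrm{res}(\mathrm{Tr}\,\Omega^{n-1}k)=\mathrm{ext}\Big(R\oplus\bigoplus_{i=0}^{n-1}\mathrm{Tr}\,\Omega^ik\Big).$$
   Context: All modules are finitely generated; $\mathrm{mod}\,R$ is the category of finitely generated $R$-modules; subcategories are full. Let $\mathfrak{m}$ be the maximal ideal of $R$. The zero module has projective dimension $-\infty$, regarded as finite. $\mathrm{PD}_0(R)$ is the subcategory of $\mathrm{mod}\,R$ of modules of finite projective dimension that are locally free on the punctured spectrum $\mathrm{Spec}\,R\setminus\{\mathfrak{m}\}$ (i.e. $M_\mathfrak{p}$ is $R_\mathfrak{p}$-free for all $\mathfrak{p}\ne\mathfrak{m}$). For $n\ge0$, $\mathrm{PD}_0^n(R)$ is the subcategory of modules of projective dimension at most $n$ that are locally free on the punctured spectrum. $\mathrm{add}\,R$ is the subcategory of direct summands of finite direct sums of copies of $R$. A resolving subcategory of $\mathrm{mod}\,R$ is a full subcategory that contains all projective modules and is closed under direct summands, extensions and syzygies (kernels of epimorphisms from projectives); $\mathrm{res}\,M$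 is the smallest resolving subcategory containing $M$. An extension-closed subcategory is one closed under direct summands and extensions; $\mathrm{ext}\,M$ is the smallest extension-closed subcategory containing $M$. $\Omega^nM$ is the $n$-th syzygy of $M$ in a minimal free resolution; $\mathrm{Tr}\,M$ is the cokernel of $\partial^*=\mathrm{Hom}_R(\partial,R):P_0^*\to P_1^*$ where $P_1\xrightarrow{\partial}P_0\to M\to0$ is the presentation coming from a minimal free resolution of $M$. *)

(* Defs.v *)
From HB Require Import structures.
From mathcomp Require Import all_boot all_order all_algebra ring_quotient.
From mathcomp Require Import generic_quotient boolp functions ring.

Set Implicit Arguments.
Unset Strict Implicit.
Unset Printing Implicit Defensive.

Import GRing.Theory.
Local Open Scope ring_scope.
Local Open Scope quotient_scope.

Section Submodule.
Variables (R : pzRingType) (V : lmodType R) (S : submodClosed V).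

Record submod := Submod { submod_val :> V; _ : submod_val \in S }.

HB.instance Definition _ := [isSub for submod_val].
HB.instance Definition _ := [Choice of submod by <:].
HB.instance Definition _ := [SubChoice_isSubLmodule of submod by <:].

(* [Quotient.quot] expects a [zmodClosed], which the library does not infer from
   a [submodClosed]. *)
Definition submod_zmod : zmodClosed V :=
  HB.pack ((S : {pred V}) : V -> bool)
    (GRing.isZmodClosed.Build V (S : {pred V})
      (GRing.submod_closedB (submodClosedP S))).

Definition lquot := @Quotient.quot V submod_zmod.

HB.instance Definition _ := GRing.Zmodule.on lquot.
HB.instance Definition _ := EqQuotient.on lquot.

Definition lquot_scale (a : R) := lift_op1 lquot ( *:%R a).

Lemma lquot_scale_pi a : {morph \pi_lquot : x / a *: x >-> lquot_scale a x}.
Proof.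
move=> x; unlock lquot_scale; apply/eqP.
rewrite -(@Quotient.idealrBE _ submod_zmod) -scalerBr rpredZ //.
by rewrite (@Quotient.idealrBE _ submod_zmod) reprK.
Qed.

Fact lquot_scaleA a b v :
  lquot_scale a (lquot_scale b v) = lquot_scale (a * b) v.
Proof. by rewrite -[v]reprK -!lquot_scale_pi scalerA. Qed.

Fact lquot_scale1 : left_id 1 lquot_scale.
Proof. by move=> v; rewrite -[v]reprK -lquot_scale_pi scale1r. Qed.

Lemma lquot_piD (x y : V) : \pi_lquot (x + y) = \pi_lquot x + \pi_lquot y.
Proof. exact: Quotient.pi_add. Qed.

Fact lquot_scaleDr : right_distributive lquot_scale +%R.
Proof.
move=> a u v; rewrite -[u]reprK -[v]reprK.
by rewrite -lquot_piD -!lquot_scale_pi scalerDr lquot_piD.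
Qed.

Fact lquot_scaleDl v : {morph lquot_scale^~ v : a b / a + b}.
Proof.
by move=> a b; rewrite -[v]reprK -!lquot_scale_pi scalerDl lquot_piD.
Qed.

HB.instance Definition _ := GRing.Zmodule_isLmodule.Build R lquot
  lquot_scaleA lquot_scale1 lquot_scaleDr lquot_scaleDl.

End Submodule.

Section Image.
Variables (R : pzRingType) (U V : lmodType R) (f : {linear U -> V}).

Definition im_pred : {pred V} := fun y => `[< exists x, f x = y >].

Fact im_pred_submod : submod_closed im_pred.
Proof.
split=> [|a _ _ /asboolP[x <-] /asboolP[y <-]]; apply/asboolP.
  by exists 0; rewrite linear0.
by exists (a *: x + y); rewrite linearP.
Qed.

HB.instance Definition _ := GRing.isSubmodClosed.Build R V im_pred
  (GRing.submod_closed_semi im_pred_submod).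

Definition image_mod : lmodType R := submod im_pred.
Definition coker_mod : lmodType R := lquot im_pred.

End Image.

Section Homomorphisms.
Variable R : pzRingType.

Definition surjective (U V : Type) (f : U -> V) := forall y, exists x, f x = y.

Definition exact_at (U V W : lmodType R) (f : {linear U -> V})
    (g : {linear V -> W}) :=
  forall y, g y = 0 <-> exists x, f x = y.

Definition isomorphic (U V : lmodType R) :=
  exists f : {linear U -> V}, bijective f.

Definition short_exact (L M N : lmodType R) :=
  exists (f : {linear L -> M}) (g : {linear M -> N}),
    [/\ injective f, exact_at f g & surjective g].

Definition direct_summand (U V : lmodType R) :=
  exists W : lmodType R, isomorphic V (U * W)%type.

Definition fin_gen (V : lmodType R) :=
  exists s : seq V, forall x, exists c : 'I_(size s) -> R,
    x = \sum_(i < size s) c i *: s`_i.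

Definition projective (P : lmodType R) :=
  forall (U V : lmodType R) (g : {linear U -> V}) (f : {linear P -> V}),
    surjective g -> exists h : {linear P -> U}, forall x, g (h x) = f x.

Definition free_fin_rank (V : lmodType R) :=
  exists n : nat, isomorphic V 'rV[R]_n.

Fixpoint direct_sum (F : nat -> lmodType R) (n : nat) : lmodType R :=
  if n is i.+1 then (direct_sum F i * F i)%type else 'rV[R]_0.

End Homomorphisms.

Section Dual.
Variable R : comPzRingType.

(* [dual V] is [Hom_R(V, R)], as a submodule of the module of all functions, and
   [dual_map f] is [Hom_R(f, R)]. *)
Definition linear_pred (V : lmodType R) : {pred V -> R^o} :=
  fun f => `[< linear f >].

Fact linear_pred_submod (V : lmodType R) : submod_closed (@linear_pred V).
Proof.
split=> [|a f g /asboolP lf /asboolP lg]; apply/asboolP => b u v.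
  by rewrite /= scaler0 addr0.
rewrite /= !scalrfctE; change (a *: f (b *: u + v) + g (b *: u + v) =
  b *: (a *: f u + g u) + (a *: f v + g v)).
rewrite lf lg !scalerDr !scalerA [a * b]mulrC -!addrA; congr (_ + _).
by rewrite addrCA.
Qed.

HB.instance Definition _ (V : lmodType R) :=
  GRing.isSubmodClosed.Build R (V -> R^o) (@linear_pred V)
    (GRing.submod_closed_semi (linear_pred_submod V)).

Definition dual (V : lmodType R) : lmodType R := submod (@linear_pred V).

Fact dual_map_subproof (U V : lmodType R) (f : {linear U -> V}) (h : dual V) :
  (submod_val h \o f : U -> R^o) \in @linear_pred U.
Proof.
case: h => h /= /asboolP lh; apply/asboolP => a u v /=.
by rewrite linearP lh.
Qed.

Definition dual_map (U V : lmodType R) (f : {linear U -> V}) (h : dual V) :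
  dual U := Submod (dual_map_subproof f h).

Fact dual_map_linear (U V : lmodType R) (f : {linear U -> V}) :
  linear (dual_map f).
Proof. by move=> a g h; apply: val_inj; apply/funext. Qed.

HB.instance Definition _ (U V : lmodType R) (f : {linear U -> V}) :=
  GRing.isLinear.Build R (dual V) (dual U) _ (dual_map f) (dual_map_linear f).

End Dual.

Section Ideals.
Variable R : comNzRingType.

Fact ideal_submod_closed (I : idealr R) :
  @GRing.submod_closed R R^o (I : {pred R}).
Proof.
by split=> [|a u v uI vI]; [exact: rpred0 | apply: rpredD; rewrite ?idealMr].
Qed.

Definition ideal_submod (I : idealr R) : submodClosed R^o :=
  HB.pack ((I : {pred R}) : R^o -> bool)
    (GRing.isSubmodClosed.Build R R^o (I : {pred R})
       (GRing.submod_closed_semi (ideal_submod_closed I))).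

Definition residue_field (m : idealr R) : lmodType R := lquot (ideal_submod m).

Definition noetherian := forall I : submodClosed R^o, fin_gen (submod I).

(* An [idealr R] is a proper ideal. *)
Definition maximal_ideal (m : idealr R) :=
  forall I : idealr R, {subset m <= I} -> I =i m.

Definition local_ring (m : idealr R) :=
  maximal_ideal m /\ forall m' : idealr R, maximal_ideal m' -> m' =i m.

(* [x] lies in the ideal generated by [s]. *)
Definition in_span (s : seq R) (x : R) :=
  exists c : 'I_(size s) -> R, x = \sum_(i < size s) c i * s`_i.

(* [s`_i] is a nonzerodivisor on [R / (s`_0, ..., s`_(i-1))] for all [i], and
   [R / (s) != 0]. *)
Definition regular_seq (s : seq R) :=
  (forall i, (i < size s)%N -> forall a,
     in_span (take i s) (a * s`_i) -> in_span (take i s) a)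
  /\ ~ in_span s 1.

(* Depth as the largest length of a regular sequence contained in [m]. *)
Definition depth_is (m : idealr R) (t : nat) :=
  (exists s, [/\ regular_seq s, {subset s <= m} & size s = t]) /\
  (forall s, regular_seq s -> {subset s <= m} -> (size s <= t)%N).

End Ideals.

Section Localization.
Variables (R : comNzRingType) (p : prime_idealr R).

Record denom := Denom { denom_val : R; _ : denom_val \notin p }.

HB.instance Definition _ := [isSub for denom_val].
HB.instance Definition _ := [Choice of denom by <:].

Lemma denomP (s : denom) : denom_val s \notin p. Proof. by case: s. Qed.

Fact denom1_subproof : 1 \notin p. Proof. by rewrite idealr1. Qed.
Definition denom1 := Denom denom1_subproof.

Fact denomM_subproof s t : denom_val s * denom_val t \notin p.
Proof. by rewrite prime_idealrM negb_or !denomP. Qed.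
Definition denomM s t := Denom (denomM_subproof s t).

Local Notation dv := denom_val.

Section Module.
Variable V : lmodType R.

(* The pair [(v, s)] stands for the fraction [v / s]. *)
Definition frac_equiv (x y : V * denom) :=
  `[< exists u, (dv u * dv y.2) *: x.1 = (dv u * dv x.2) *: y.1 >].

Fact frac_equiv_is_equiv : equiv_class_of frac_equiv.
Proof.
split=> [[v s]|[v s] [w t]|[w t] [v s] [z r]].
- by apply/asboolP; exists denom1.
- by apply/asboolP/asboolP => -[u e]; exists u.
move=> /asboolP[u /= e1] /asboolP[u' /= e2]; apply/asboolP.
exists (denomM (denomM u u') t) => /=.
transitivity ((dv u' * dv r) *: ((dv u * dv t) *: v)).
  by rewrite scalerA; congr (_ *: _); ring.
rewrite e1 scalerA.
transitivity ((dv u * dv s) *: ((dv u' * dv r) *: w)).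
  by rewrite scalerA; congr (_ *: _); ring.
by rewrite e2 scalerA; congr (_ *: _); ring.
Qed.

Canonical frac_equiv_equiv := EquivRelPack frac_equiv_is_equiv.
Canonical frac_encModRel := defaultEncModRel frac_equiv.

Definition localization := {eq_quot frac_equiv}.

HB.instance Definition _ : EqQuotient _ frac_equiv localization :=
  EqQuotient.on localization.
HB.instance Definition _ := Choice.on localization.

Definition frac (v : V) (s : denom) : localization := \pi_localization (v, s).

Lemma fracP v s w t :
  frac v s = frac w t <-> exists u, (dv u * dv t) *: v = (dv u * dv s) *: w.
Proof.
split=> [/eqmodP/asboolP //|h]; exact/eqmodP/asboolP.
Qed.

Lemma frac_surj (x : localization) : exists v s, x = frac v s.
Proof.
by exists (repr x).1, (repr x).2; rewrite /frac -surjective_pairing reprK.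
Qed.

Definition loc_num (x : localization) := (repr x).1.
Definition loc_den (x : localization) := (repr x).2.

Lemma frac_numden x : frac (loc_num x) (loc_den x) = x.
Proof. by rewrite /frac -surjective_pairing reprK. Qed.

Definition loc_zero := frac 0 denom1.
Definition loc_opp x := frac (- loc_num x) (loc_den x).
Definition loc_add x y :=
  frac (dv (loc_den y) *: loc_num x + dv (loc_den x) *: loc_num y)
       (denomM (loc_den x) (loc_den y)).

Lemma loc_oppE v s : loc_opp (frac v s) = frac (- v) s.
Proof.
have /fracP[u e] := frac_numden (frac v s).
by apply/fracP; exists u; rewrite !scalerN e.
Qed.

Lemma loc_addE v s w t :
  loc_add (frac v s) (frac w t) = frac (dv t *: v + dv s *: w) (denomM s t).
Proof.
have /fracP[u e] := frac_numden (frac v s).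
have /fracP[u' e'] := frac_numden (frac w t).
rewrite /loc_add.
move: (loc_num _) (loc_den _) e (loc_num _) (loc_den _) e'.
move=> v1 s1 e w1 t1 e'.
apply/fracP; exists (denomM u u'); rewrite /= !scalerDr !scalerA; congr (_ + _).
  transitivity ((dv u' * dv t * dv t1) *: ((dv u * dv s) *: v1)).
    by rewrite scalerA; congr (_ *: _); ring.
  by rewrite e scalerA; congr (_ *: _); ring.
transitivity ((dv u * dv s * dv s1) *: ((dv u' * dv t) *: w1)).
  by rewrite scalerA; congr (_ *: _); ring.
by rewrite e' scalerA; congr (_ *: _); ring.
Qed.

Lemma frac_eq v s w t : dv t *: v = dv s *: w -> frac v s = frac w t.
Proof. by move=> e; apply/fracP; exists denom1; rewrite /= !mul1r. Qed.

Fact loc_addA : associative loc_add.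
Proof.
move=> x y z; have [v [s ->]] := frac_surj x; have [w [t ->]] := frac_surj y.
have [a [r ->]] := frac_surj z; rewrite !loc_addE; apply: frac_eq => /=.
rewrite !scalerDr !scalerA -!addrA.
by congr (_ *: _ + (_ *: _ + _ *: _)); ring.
Qed.

Fact loc_addC : commutative loc_add.
Proof.
move=> x y; have [v [s ->]] := frac_surj x; have [w [t ->]] := frac_surj y.
rewrite !loc_addE; apply: frac_eq => /=; rewrite addrC.
by congr (_ *: _); ring.
Qed.

Fact loc_add0 : left_id loc_zero loc_add.
Proof.
move=> x; have [v [s ->]] := frac_surj x; rewrite loc_addE; apply: frac_eq.
by rewrite /= scaler0 add0r scale1r mul1r.
Qed.

Fact loc_addN : left_inverse loc_zero loc_opp loc_add.
Proof.
move=> x; have [v [s ->]] := frac_surj x; rewrite loc_oppE loc_addE.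
by apply: frac_eq; rewrite /= !scalerN addNr !scaler0.
Qed.

HB.instance Definition _ :=
  GRing.isZmodule.Build localization loc_addA loc_addC loc_add0 loc_addN.

Lemma fracD v s w t :
  frac v s + frac w t = frac (dv t *: v + dv s *: w) (denomM s t).
Proof. exact: loc_addE. Qed.

End Module.

Definition loc_ring := localization R^o.

HB.instance Definition _ := GRing.Zmodule.on loc_ring.

Section Scale.
Variable V : lmodType R.

Definition loc_scale (a : loc_ring) (x : localization V) : localization V :=
  frac ((loc_num a : R) *: loc_num x) (denomM (loc_den a) (loc_den x)).

Lemma loc_scaleE (a : R) s (v : V) t :
  loc_scale (frac (a : R^o) s) (frac v t) = frac (a *: v) (denomM s t).
Proof.
have /fracP[u e] := frac_numden (frac (a : R^o) s).
have /fracP[u' e'] := frac_numden (frac v t).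
rewrite /loc_scale.
move: (loc_num _) (loc_den _) e (loc_num _) (loc_den _) e'.
move=> a1 s1 e v1 t1 e'.
have {}e : dv u * dv s * (a1 : R) = dv u * dv s1 * a by exact: e.
apply/fracP; exists (denomM u u'); rewrite /= !scalerA.
transitivity ((dv u * dv s * (a1 : R)) *: ((dv u' * dv t) *: v1)).
  by rewrite scalerA; congr (_ *: _); ring.
by rewrite e' e scalerA; congr (_ *: _); ring.
Qed.

End Scale.

Definition loc_one : loc_ring := frac (1 : R^o) denom1.
Definition loc_mul (a b : loc_ring) : loc_ring := loc_scale a b.

Lemma loc_mulE (a : R) s (b : R) t :
  loc_mul (frac (a : R^o) s) (frac (b : R^o) t)
    = frac ((a * b : R) : R^o) (denomM s t).
Proof. exact: loc_scaleE. Qed.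

Lemma frac_eqr (a : R) s (b : R) t :
  dv t * a = dv s * b -> frac (a : R^o) s = frac (b : R^o) t.
Proof. exact: (@frac_eq R^o). Qed.

Lemma fracDr (a : R) s (b : R) t :
  frac (a : R^o) s + frac (b : R^o) t
    = frac ((dv t * a + dv s * b : R) : R^o) (denomM s t).
Proof. exact: (@fracD R^o). Qed.

Fact loc_mulA : associative loc_mul.
Proof.
move=> x y z; have [v [s ->]] := frac_surj x; have [w [t ->]] := frac_surj y.
have [a [r ->]] := frac_surj z.
by rewrite (loc_mulE w t a r) (loc_mulE v s w t) !loc_mulE;
  apply: frac_eqr => /=; ring.
Qed.

Fact loc_mulC : commutative loc_mul.
Proof.
move=> x y; have [v [s ->]] := frac_surj x; have [w [t ->]] := frac_surj y.
rewrite !loc_mulE; apply: frac_eqr => /=; ring.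
Qed.

Fact loc_mul1 : left_id loc_one loc_mul.
Proof.
move=> x; have [v [s ->]] := frac_surj x.
by rewrite loc_mulE; apply: frac_eqr => /=; ring.
Qed.

Fact loc_mulDl : left_distributive loc_mul +%R.
Proof.
move=> x y z; have [v [s ->]] := frac_surj x; have [w [t ->]] := frac_surj y.
have [a [r ->]] := frac_surj z.
by rewrite fracDr !loc_mulE fracDr; apply: frac_eqr => /=; ring.
Qed.

HB.instance Definition _ := GRing.Zmodule_isComPzRing.Build loc_ring
  loc_mulA loc_mulC loc_mul1 loc_mulDl.

Section LocModule.
Variable V : lmodType R.
Implicit Types (a b : loc_ring) (x y : localization V).

Fact loc_scaleA a b x : loc_scale a (loc_scale b x) = loc_scale (a * b) x.
Proof.
have [c [s ->]] := frac_surj a; have [d [t ->]] := frac_surj b.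
have [v [r ->]] := frac_surj x.
rewrite -[_ * _]/(loc_mul (frac c s) (frac d t)) loc_mulE.
rewrite (loc_scaleE d t v r) !loc_scaleE; apply: frac_eq => /=.
by rewrite !scalerA; congr (_ *: _); ring.
Qed.

Fact loc_scale1 : left_id 1 (@loc_scale V).
Proof.
move=> x; have [v [s ->]] := frac_surj x.
by rewrite loc_scaleE scale1r; apply: frac_eq; rewrite /= mul1r.
Qed.

Fact loc_scaleDr : right_distributive (@loc_scale V) +%R.
Proof.
move=> a x y; have [c [s ->]] := frac_surj a.
have [v [t ->]] := frac_surj x; have [w [r ->]] := frac_surj y.
rewrite fracD !loc_scaleE fracD; apply: frac_eq => /=.
by rewrite !scalerDr !scalerA; congr (_ *: _ + _ *: _); ring.
Qed.

Fact loc_scaleDl x : {morph (@loc_scale V)^~ x : a b / a + b}.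
Proof.
move=> a b; have [c [s ->]] := frac_surj a; have [d [t ->]] := frac_surj b.
have [v [r ->]] := frac_surj x.
rewrite fracDr !loc_scaleE fracD; apply: frac_eq => /=.
by rewrite !scalerDr !scalerA -scalerDl; congr (_ *: _); ring.
Qed.

HB.instance Definition _ := GRing.Zmodule_isLmodule.Build loc_ring
  (localization V) loc_scaleA loc_scale1 loc_scaleDr loc_scaleDl.

End LocModule.

End Localization.

Section ProjectiveDimension.
Variable R : comNzRingType.

(* The zero module, of projective dimension -oo, satisfies [pd_le 0]. *)
Definition pd_le (n : nat) (M : lmodType R) :=
  exists (P : nat -> lmodType R) (d : forall i, {linear P i.+1 -> P i})
      (e : {linear P 0 -> M}),
    [/\ forall i, fin_gen (P i) /\ projective (P i),
        surjective e, exact_at (d 0) e, forall i, exact_at (d i.+1) (d i)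
      & forall i, (n < i)%N -> forall x : P i, x = 0].

Definition locally_free_punctured (m : idealr R) (M : lmodType R) :=
  forall p : prime_idealr R, ~ (p =i m) ->
    free_fin_rank (localization p M : lmodType (loc_ring p)).

Definition PD0 (m : idealr R) (M : lmodType R) :=
  [/\ fin_gen M, (exists n, pd_le n M) & locally_free_punctured m M].

Definition PD0n (m : idealr R) (n : nat) (M : lmodType R) :=
  [/\ fin_gen M, pd_le n M & locally_free_punctured m M].

Definition add_ring (M : lmodType R) :=
  exists n : nat, direct_summand M 'rV[R]_n.

End ProjectiveDimension.

Section Subcategories.
Variable R : comNzRingType.

(* A full subcategory is given by its class of objects; [set] cannot be used
   here for universe reasons. *)
Definition subcat := lmodType R -> Prop.
Implicit Types X Y : subcat.

Definition subcat_sub X Y := forall M, X M -> Y M.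
Definition subcat_eq X Y := forall M, X M <-> Y M.
Definition subcat_proper X Y := subcat_sub X Y /\ ~ subcat_sub Y X.

Definition summand_closed X := forall M N, X M -> direct_summand N M -> X N.
Definition extension_stable X :=
  forall L M N, short_exact L M N -> X L -> X N -> X M.

Definition extension_closed X :=
  [/\ subcat_sub X (@fin_gen R), summand_closed X & extension_stable X].

Definition resolving X :=
  [/\ extension_closed X,
      forall P, fin_gen P -> projective P -> X P
    & forall N P M, short_exact N P M -> fin_gen P -> projective P ->
        X M -> X N].

Definition res (M : lmodType R) : subcat :=
  fun N => forall X, resolving X -> X M -> X N.
Definition ext (M : lmodType R) : subcat :=
  fun N => forall X, extension_closed X -> X M -> X N.

End Subcategories.

Section MinimalResolution.
Variables (R : comNzRingType) (m : idealr R).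

Record free_complex (M : lmodType R) := FreeComplex {
  fc_rank : nat -> nat;
  fc_diff : forall i, {linear 'rV[R]_(fc_rank i.+1) -> 'rV[R]_(fc_rank i)};
  fc_aug : {linear 'rV[R]_(fc_rank 0) -> M}
}.

(* Minimality: the image of each differential is contained in [m F_i]. *)
Definition minimal_resolution (M : lmodType R) (F : free_complex M) :=
  [/\ surjective (fc_aug F), exact_at (fc_diff F 0) (fc_aug F),
      forall i, exact_at (fc_diff F i.+1) (fc_diff F i)
    & forall i x j, fc_diff F i x 0 j \in m].

Definition zero_complex (M : lmodType R) : free_complex M :=
  @FreeComplex M (fun=> 0%N) (fun=> \0) \0.

(* A chosen minimal free resolution: over a noetherian local ring every finitely
   generated module has one, unique up to isomorphism.  [zero_complex] is only a
   dummy value for the modules that have none. *)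
Definition min_res (M : lmodType R) : free_complex M :=
  if pselect (exists F : free_complex M, minimal_resolution F) is left e
  then sval (cid e) else zero_complex M.

Definition syzygy (n : nat) (M : lmodType R) : lmodType R :=
  if n is i.+1 then image_mod (fc_diff (min_res M) i) else M.

Definition transpose (M : lmodType R) : lmodType R :=
  coker_mod (dual_map (fc_diff (min_res M) 0)).

End MinimalResolution.

(* Main.v *)
Require Import Defs.
From HB Require Import structures.
From mathcomp Require Import all_boot all_order all_algebra ring_quotient.
From mathcomp Require Import generic_quotient boolp functions ring.

(* Local freeness of [M] on the punctured spectrum means that every element of [m]
   has a power that acts on [M] through a free module; this condition obviously
   passes to summands, extensions and syzygies.

   Since [R] has depth [t], the dual of a free resolution of [k] is exact in
   degrees below [t].  Hence [T_j = Tr Omega^j k] has projective dimension [j + 1]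
   for [j < t], and there are exact sequences [0 -> T_(j-1) -> G_j -> T_j -> 0]
   with [G_j] free and [T_(-1) = R].

   Let [M] be in [PD_0^n] and let [Ext^i(M, R)] be the first nonvanishing [Ext],
   [0 < i].  It has finite length, and a nonzero socle element of it corresponds to
   a map [M -> T_(i-1)].  The kernel [M'] of the induced surjection
   [M + G_(i-1) -> T_(i-1)] has the same [Ext]s as [M], except that the chosen
   element of [Ext^i] has been killed.  Iterating, one reaches a module with
   [Ext^1 = ... = Ext^n = 0], which is free; so [PD_0^n] lies in every
   extension-closed subcategory containing [R, T_0, ..., T_(n-1)].

   Conversely, let a resolving [X] contain [M] of projective dimension exactly
   [n > 0].  By induction, applied to a syzygy of [M], it contains [PD_0^(n-1)].
   A surjection [Ext^n(M, R) -> k] lifts to a map of complexes whose dual induces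
   an exact sequence [0 -> K -> T_(n-1) + F -> M -> 0] with [F] free and
   [pd K < n].  Thus [T_(n-1)] is in [X], and then so is [PD_0^n].

   That [n <= t] is the Auslander-Buchsbaum bound: modulo a maximal regular
   sequence there is a socle element [z], and [z e] is killed by the last map of a
   minimal resolution for a basis vector [e], while [Tor] of [M] against the
   quotient of [R] by the sequence vanishes beyond degree [t]. *)

Set Implicit Arguments.
Unset Strict Implicit.
Unset Printing Implicit Defensive.

Import GRing.Theory.
Local Open Scope ring_scope.

(** * Linear maps, kernels, cokernels and retracts *)

Section LinearMaps.
Variable R : comPzRingType.
Implicit Types U V W X : lmodType R.

Definition mklin U V (f : U -> V) (lf : linear f) : {linear U -> V} :=
  HB.pack f (GRing.isLinear.Build R U V _ f lf).

(** Lifts, factorizations and maps into pullbacks are all specified by relations. Linearity of [P]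
    reduces uniqueness of the value to the fibre over 0, and choice then gives the map. *)
Lemma linear_of_rel U V (P : U -> V -> Prop) :
  (forall x, exists y, P x y) ->
  (forall a x y x' y', P x y -> P x' y' -> P (a *: x + x') (a *: y + y')) ->
  (forall y, P 0 y -> y = 0) ->
  exists f : {linear U -> V}, forall x y, P x y <-> f x = y.
Proof.
move=> tot lin fun0.
have uniq x y y' : P x y -> P x y' -> y = y'.
  move=> Py Py'; have := lin (-1) _ _ _ _ Py' Py.
  by rewrite !scaleN1r addNr => /fun0/eqP; rewrite addrC subr_eq0 => /eqP.
pose f x := sval (cid (tot x)).
have fP x : P x (f x) := svalP (cid (tot x)).
have lf : linear f by move=> a x y;
  apply: uniq (fP _) (lin _ _ _ _ _ (fP x) (fP y)).
exists (mklin lf) => x y; split=> [Py | <-]; last exact: fP.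
exact: uniq (fP x) Py.
Qed.

Lemma linear_inj U V (f : {linear U -> V}) :
  (forall x, f x = 0 -> x = 0) -> injective f.
Proof.
move=> f0 x y fxy; apply/eqP; rewrite -subr_eq0; apply/eqP/f0.
by rewrite linearB fxy subrr.
Qed.

Lemma linear_lift U V W (i : {linear U -> V}) (f : {linear W -> V}) :
  injective i -> (forall w, exists u, i u = f w) ->
  exists h : {linear W -> U}, forall w, i (h w) = f w.
Proof.
move=> ii fi; have [||h hP] := @linear_of_rel W U (fun w u => i u = f w) fi.
- by move=> a x y x' y' e e'; rewrite !linearP e e'.
- by move=> y; rewrite linear0 -(linear0 i); apply: ii.
by exists h => w; apply/hP.
Qed.

Lemma linear_factor U V W (p : {linear U -> V}) (f : {linear U -> W}) :
  surjective p -> (forall u, p u = 0 -> f u = 0) ->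
  exists h : {linear V -> W}, forall u, h (p u) = f u.
Proof.
move=> sp pf.
have [|||h hP] := @linear_of_rel V W (fun v w => exists2 u, p u = v & f u = w).
- by move=> v; have [u pu] := sp v; exists (f u), u.
- move=> a _ _ _ _ [u <- <-] [u' <- <-].
  by exists (a *: u + u'); rewrite linearP.
- by move=> _ [u /pf pu <-].
by exists h => u; apply/hP; exists u.
Qed.

Lemma ker_exists U V (f : {linear U -> V}) :
  exists (K : lmodType R) (i : {linear K -> U}), injective i /\ exact_at i f.
Proof.
pose S : {pred U} := fun x => f x == 0.
have Sc : GRing.submod_closed S.
  split=> [|a x y /eqP fx /eqP fy]; apply/eqP; first by rewrite linear0.
  by rewrite linearP fx fy scaler0 addr0.
pose SS : submodClosed U :=
  HB.pack (S : U -> bool) (GRing.isSubmodClosed.Build R U S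
    (GRing.submod_closed_semi Sc)).
have lv : linear (@submod_val _ _ SS) by [].
exists (submod SS), (mklin lv); split=> [x y /val_inj //|x].
split=> [fx | [y <-]].
  have xS : x \in SS by apply/eqP.
  by exists (Submod xS).
by case: y => y yS; apply/eqP.
Qed.

Lemma coker_piP U V (f : {linear U -> V}) :
  exists q : {linear V -> coker_mod f}, surjective q /\ exact_at f q.
Proof.
have lq : linear (\pi_(lquot (im_pred f))%qT : V -> coker_mod f).
  by move=> a x y; rewrite lquot_piD lquot_scale_pi.
exists (mklin lq); split=> [y|y].
  by exists (repr y); rewrite /= reprK.
have e : mklin lq y = mklin lq 0 <-> y \in im_pred f.
  rewrite -[y in y \in _]subr0.
  by rewrite (@Quotient.idealrBE _ (submod_zmod (im_pred f)));
    split=> [/eqP|/eqP].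
rewrite linear0 in e; by apply: (iff_trans e); split=> /asboolP.
Qed.

Fact pairl_subproof X U V (f : {linear X -> U}) (g : {linear X -> V}) :
  linear (fun x => (f x, g x) : (U * V)%type).
Proof. by move=> a x y; rewrite !linearP. Qed.

Definition pairl X U V (f : {linear X -> U}) (g : {linear X -> V}) :
  {linear X -> (U * V)%type} := mklin (pairl_subproof f g).

Definition copair U V X (f : {linear U -> X}) (g : {linear V -> X}) :
  {linear (U * V)%type -> X} := (f \o fst) \+ (g \o snd).

Lemma pairlE X U V (f : {linear X -> U}) (g : {linear X -> V}) x :
  pairl f g x = (f x, g x).
Proof. by []. Qed.

Lemma copairE U V X (f : {linear U -> X}) (g : {linear V -> X}) x :
  copair f g x = f x.1 + g x.2.
Proof. by []. Qed.

Fact row_lin_subproof n V (v : 'I_n -> V) :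
  linear (fun x : 'rV[R]_n => \sum_i x 0 i *: v i).
Proof.
move=> a x y; rewrite scaler_sumr -big_split; apply: eq_bigr => i _.
by rewrite !mxE scalerDl scalerA.
Qed.

Definition row_lin n V (v : 'I_n -> V) : {linear 'rV[R]_n -> V} :=
  mklin (row_lin_subproof v).

Lemma row_linE n V (v : 'I_n -> V) x : row_lin v x = \sum_i x 0 i *: v i.
Proof. by []. Qed.

Lemma row_lin_delta n V (v : 'I_n -> V) i : row_lin v (delta_mx 0 i) = v i.
Proof.
rewrite row_linE (bigD1 i) //= big1 ?addr0 => [|j ne]; rewrite mxE !eqxx.
  by rewrite scale1r.
by rewrite (negPf ne) scale0r.
Qed.

Lemma linear_rowE n V (f : {linear 'rV[R]_n -> V}) x :
  f x = \sum_i x 0 i *: f (delta_mx 0 i).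
Proof.
rewrite {1}[x]row_sum_delta linear_sum; apply: eq_bigr => i _.
by rewrite linearZ.
Qed.

Lemma linear_row_ext n V (f g : {linear 'rV[R]_n -> V}) :
  (forall i, f (delta_mx 0 i) = g (delta_mx 0 i)) -> forall x, f x = g x.
Proof.
by move=> e x; rewrite !(linear_rowE _ x); apply: eq_bigr => i _; rewrite e.
Qed.

Lemma fin_genP V :
  fin_gen V <-> exists n (e : {linear 'rV[R]_n -> V}), surjective e.
Proof.
split=> [[s sP]|[n [e se]]].
  exists (size s), (row_lin (fun i : 'I_(size s) => s`_i)) => x.
  have [c ->] := sP x; exists (\row_i c i).
  by rewrite row_linE; apply: eq_bigr => i _; rewrite mxE.
exists [seq e (delta_mx 0 i) | i <- enum 'I_n] => x; have [y <-] := se x.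
rewrite size_map size_enum_ord; exists (fun i => y 0 i).
rewrite linear_rowE; apply: eq_bigr => i _; congr (_ *: _).
by rewrite (nth_map i) ?size_enum_ord ?nth_ord_enum.
Qed.

Lemma fin_gen_surj U V (f : {linear U -> V}) :
  surjective f -> fin_gen U -> fin_gen V.
Proof.
move=> sf /fin_genP[n [e se]]; apply/fin_genP; exists n, (f \o e) => y.
by have [u <-] := sf y; have [x <-] := se u; exists x.
Qed.

Lemma isomorphic_sym U V : isomorphic U V -> isomorphic V U.
Proof.
case=> f [g fK gK].
have lg : linear g.
  by move=> a x y; apply: (can_inj fK); rewrite linearP !gK.
by exists (mklin lg), f.
Qed.

Lemma isomorphic_bij U V (f : {linear U -> V}) :
  injective f -> surjective f -> isomorphic U V.
Proof.
move=> fi sf; exists f; pose g y := sval (cid (sf y)).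
have fg : cancel g f by move=> y; rewrite /g; case: (cid _).
by exists g => // x; apply: fi; rewrite fg.
Qed.

(** For the converse the complement is the kernel of [p], onto which [idfun \- (i \o p)]
    projects. *)
Lemma summand_retract U V :
  direct_summand U V <->
  exists (i : {linear U -> V}) (p : {linear V -> U}), forall x, p (i x) = x.
Proof.
split=> [[W [f [g fK gK]]]|[i [p pi]]].
  have lg : linear g by move=> a x y; apply: (can_inj fK); rewrite linearP !gK.
  exists (mklin lg \o pairl idfun \0), (fst \o f) => x /=.
  by rewrite gK.
have [K [j [ij jP]]] := ker_exists p.
have [|h hP] := @linear_lift _ _ V j (idfun \- (i \o p)) ij.
  by move=> v; apply/jP; rewrite /= linearB /= pi subrr.
exists K; apply: (isomorphic_bij (f := pairl p h)).
  apply: linear_inj => x [px hx]; have := hP x.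
  by rewrite hx linear0 /= px linear0 subr0.
move=> [u k]; exists (i u + j k); have pj : p (j k) = 0 by apply/jP; exists k.
rewrite pairlE linearD pi pj addr0; congr (_, _); apply: ij.
by rewrite hP /= linearD pi pj addr0 addrAC subrr add0r.
Qed.

End LinearMaps.

(** * Short exact sequences and projective modules *)

Section ShortExact.
Variable R : comPzRingType.
Implicit Types L M N P U V W : lmodType R.

(** [short_exact] with its two maps exposed, as diagram chases need them. *)
Definition ses L M N (i : {linear L -> M}) (p : {linear M -> N}) :=
  [/\ injective i, exact_at i p & surjective p].

Definition fg_proj P := fin_gen P /\ projective P.

Lemma ses0 L M N (i : {linear L -> M}) (p : {linear M -> N}) x :
  ses i p -> p (i x) = 0.
Proof. by case=> _ e _; apply/e; exists x. Qed.

Lemma ses_short L M N (i : {linear L -> M}) (p : {linear M -> N}) :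
  ses i p -> short_exact L M N.
Proof. by exists i, p. Qed.

Lemma ses_surj M N (p : {linear M -> N}) : surjective p ->
  exists (L : lmodType R) (i : {linear L -> M}), ses i p.
Proof. by move=> sp; have [L [i [ii e]]] := ker_exists p; exists L, i. Qed.

Lemma ses_inj L M (i : {linear L -> M}) : injective i ->
  exists (N : lmodType R) (p : {linear M -> N}), ses i p.
Proof. by move=> ii; have [q [sq e]] := coker_piP i;
  exists (coker_mod i), q. Qed.

Lemma ses_prod L M : ses (pairl idfun \0 : {linear L -> (L * M)%type}) snd.
Proof.
split=> [x y []//|[x y]|y]; last by exists (0, y).
by split=> [/= ->|[z [_ <-]]] //; exists x.
Qed.

Lemma ses_split_iso L M N (i : {linear L -> M}) (p : {linear M -> N})
    (s : {linear N -> M}) :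
  ses i p -> (forall x, p (s x) = x) -> isomorphic (L * N)%type M.
Proof.
move=> sip ps; have [ii e sp] := sip.
apply: (isomorphic_bij (f := copair i s)) => [|m].
  apply: linear_inj => -[l n]; rewrite copairE /= => h.
  have n0 : n = 0.
    by have := congr1 p h; rewrite linearD ps (ses0 _ sip) linear0 add0r.
  congr (_, _) => //; apply: ii; move: h.
  by rewrite n0 !linear0 addr0.
have /e[l il] : p (m - s (p m)) = 0 by rewrite linearB ps subrr.
by exists (l, p m); rewrite copairE /= il subrK.
Qed.

Lemma ses_retract_iso L M N (i : {linear L -> M}) (p : {linear M -> N})
    (r : {linear M -> L}) :
  ses i p -> (forall x, r (i x) = x) -> isomorphic (L * N)%type M.
Proof.
move=> sip ri; have [ii e sp] := sip.
have [|s sP] := linear_factor (f := idfun \- (i \o r)) sp.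
  by move=> m /e[l <-] /=; rewrite ri subrr.
apply: (ses_split_iso (s := s) sip) => x; have [m <-] := sp x.
by rewrite sP /= linearB /= (ses0 _ sip) subr0.
Qed.

Lemma projective_row n : projective 'rV[R]_n.
Proof.
move=> U V g f sg; pose u i := sval (cid (sg (f (delta_mx 0 i)))).
exists (row_lin u) => x; apply: (linear_row_ext (f := g \o row_lin u)) => i.
by rewrite -[LHS]/(g (row_lin u _)) row_lin_delta /u; case: cid.
Qed.

Lemma fg_proj_row n : fg_proj 'rV[R]_n.
Proof.
split; last exact: projective_row.
by apply/fin_genP; exists n, idfun => x; exists x.
Qed.

Lemma fg_proj_retract P V (i : {linear P -> V}) (p : {linear V -> P}) :
  (forall x, p (i x) = x) -> fg_proj V -> fg_proj P.
Proof.
move=> pi [fV pV]; split.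
  by apply: (fin_gen_surj (f := p)) fV => x; exists (i x).
move=> A B g f sg; have [h hP] := pV _ _ g (f \o p) sg.
by exists (h \o i) => x; rewrite /= hP /= pi.
Qed.

Lemma fg_projP P : fg_proj P <->
  exists n (i : {linear P -> 'rV[R]_n}) (p : {linear 'rV[R]_n -> P}),
    forall x, p (i x) = x.
Proof.
split=> [[/fin_genP[n [e se]] pP]|[n [i [p pi]]]]; last first.
  exact: fg_proj_retract pi (fg_proj_row n).
by have [h hP] := pP _ _ e idfun se; exists n, h, e.
Qed.

Lemma fg_proj_iso U V : isomorphic U V -> fg_proj U -> fg_proj V.
Proof.
case=> f [g fK gK].
have lg : linear g by move=> a x y; apply: (can_inj fK); rewrite linearP !gK.
exact: (fg_proj_retract (i := mklin lg) (p := f) gK).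
Qed.

Lemma fg_proj_summand U V : direct_summand U V -> fg_proj V -> fg_proj U.
Proof. by move=> /summand_retract[i [p pi]]; apply: fg_proj_retract pi. Qed.

Lemma fin_gen_ext L M N (i : {linear L -> M}) (p : {linear M -> N}) :
  ses i p -> fin_gen L -> fin_gen N -> fin_gen M.
Proof.
move=> [ii e sp] /fin_genP[a [f sf]] /fin_genP[b [g sg]]; apply/fin_genP.
have [h hP] := projective_row g sp.
exists (a + b)%N, ((i \o f \o @lsubmx R 1 a b) \+ (h \o @rsubmx R 1 a b)) => m.
have [y yE] := sg (p m).
have /e[l il] : p (m - h y) = 0 by rewrite linearB hP yE subrr.
have [x xE] := sf l; exists (row_mx x y).
by rewrite /= row_mxKl row_mxKr xE il subrK.
Qed.

Lemma fin_gen_prod U V : fin_gen U -> fin_gen V -> fin_gen (U * V)%type.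
Proof. exact: fin_gen_ext (ses_prod U V). Qed.

Lemma fg_proj_prod U V : fg_proj U -> fg_proj V -> fg_proj (U * V)%type.
Proof.
move=> [fU pU] [fV pV]; split; first exact: fin_gen_prod.
move=> A B g f sg.
have [h hP] := pU _ _ g (f \o pairl idfun \0) sg.
have [k kP] := pV _ _ g (f \o pairl \0 idfun) sg.
exists (copair h k) => -[u v]; rewrite copairE linearD hP kP /= -linearD.
by congr (f _); congr (_, _); rewrite /= ?addr0 ?add0r.
Qed.

Lemma isomorphic_trans U V W : isomorphic U V -> isomorphic V W ->
  isomorphic U W.
Proof. by move=> [f bf] [g bg]; exists (g \o f); apply: bij_comp. Qed.

Lemma isomorphic_prod U U' V V' : isomorphic U U' -> isomorphic V V' ->
  isomorphic (U * V)%type (U' * V')%type.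
Proof.
move=> [f [f' fK f'K]] [g [g' gK g'K]].
exists (pairl (f \o fst) (g \o snd)).
exists (fun x => (f' x.1, g' x.2)) => -[x y] /=.
  by rewrite fK gK.
by rewrite f'K g'K.
Qed.

Lemma row_succ_iso n : isomorphic (R^o * 'rV[R]_n)%type 'rV[R]_n.+1.
Proof.
apply: isomorphic_sym.
have l1 : linear (fun x : 'rV[R]_n.+1 => x 0 0 : R^o) by move=> a x y;
  rewrite !mxE.
have l2 : linear (fun x : 'rV[R]_n.+1 => rsubmx (x : 'rV_(1 + n))).
  by move=> a x y; apply/rowP => i; rewrite !mxE.
exists (pairl (mklin l1) (mklin l2)).
exists (fun y => row_mx (y.1%:M : 'M_1) y.2 : 'rV_(1 + n)) => [x|[a y]].
  apply/rowP => i; rewrite !mxE; case: splitP => j /=.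
    by rewrite ord1 => ij; rewrite mxE mulr1n; congr (x _ _); apply: val_inj.
  by move=> ij; rewrite !mxE; congr (x _ _); apply: val_inj; rewrite /= ij.
rewrite pairlE /=; congr (_, _); last by rewrite row_mxKr.
rewrite !mxE; case: splitP => j //=; rewrite ord1 => _; by rewrite mxE.
Qed.

Lemma fg_proj_regular : fg_proj R^o.
Proof.
have := fg_proj_iso (isomorphic_sym (row_succ_iso 0)) (fg_proj_row 1).
apply: (@fg_proj_retract _ _ (pairl idfun \0) fst) => x //.
Qed.

Lemma ses_proj_split L M N (i : {linear L -> M}) (p : {linear M -> N}) :
  ses i p -> fg_proj N -> isomorphic (L * N)%type M.
Proof.
move=> sip [_ pN]; have [s sP] : exists s : {linear N -> M}, forall x,
  p (s x) = x.
  by case: sip => _ _ sp; apply: (pN _ _ p idfun sp).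
exact: ses_split_iso sip sP.
Qed.

(* Every linear form on [N] extends along [i]: for [0 -> N -> F -> M -> 0] with
   [F] projective this says [Ext^1(M, R) = 0]. *)
Definition forms_extend N V (i : {linear N -> V}) :=
  forall u : {linear N -> R^o}, exists v : {linear V -> R^o},
    forall x, v (i x) = u x.

(** A map to [P] is a row of forms followed by a retraction, so it is enough to extend the forms
    [c \o u]. In degree 0, where not every form extends, this weaker hypothesis is the one
    available. *)
Lemma extend_to_proj N V P (i : {linear N -> V}) (u : {linear N -> P}) :
  fg_proj P ->
  (forall c : {linear P -> R^o}, exists v : {linear V -> R^o},
     forall x, v (i x) = c (u x)) ->
  exists v : {linear V -> P}, forall x, v (i x) = u x.
Proof.
move=> /fg_projP[n [s [r rs]]] ext.
have lc j : linear (fun x => s x 0 j : R^o) by move=> a x y;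
  rewrite linearP !mxE.
pose v j := sval (cid (ext (mklin (lc j)))).
have vP j x : v j (i x) = s (u x) 0 j by rewrite /v; case: cid => /= w ->.
have lv : linear (fun x => \row_j (v j x : R)).
  by move=> a x y; apply/rowP => j; rewrite !mxE linearP.
exists (r \o mklin lv) => x /=; rewrite -[RHS]rs; congr (r _).
by apply/rowP => j; rewrite mxE vP.
Qed.

Lemma forms_extend_proj N V P (i : {linear N -> V}) (u : {linear N -> P}) :
  forms_extend i -> fg_proj P ->
  exists v : {linear V -> P}, forall x, v (i x) = u x.
Proof.
by move=> ext fP; apply: extend_to_proj fP _ => c; apply: (ext (c \o u)).
Qed.

End ShortExact.

(** * Finitely generated projectives over a local ring are free *)

Section LocalProjective.
Variable A : comPzRingType.
Hypothesis locA :
  forall a : A, (exists b, a * b = 1) \/ (exists b, (1 - a) * b = 1).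

(* The free rank-one factor can be split off or dropped according to whether
   the corresponding diagonal entry [a] of the idempotent, or [1 - a], is
   invertible. *)
Lemma retract_row_free n (P : lmodType A) (i : {linear P -> 'rV[A]_n})
  (p : {linear 'rV[A]_n -> P}) : (forall x, p (i x) = x) -> free_fin_rank P.
Proof.
elim: n P i p => [|n IHn] P i0 p0 pi0.
  have P0 x : x = 0 :> P by rewrite -(pi0 x) (thinmx0 (i0 x)) linear0.
  exists 0%N, \0; exists (fun=> 0) => x; first by rewrite (P0 x).
  by rewrite [RHS]thinmx0.
have [i [p pi]] : exists (i : {linear P -> (A^o * 'rV[A]_n)%type})
    (p : {linear (A^o * 'rV[A]_n)%type -> P}), forall x, p (i x) = x.
  have [f [g gf fg]] := row_succ_iso A n.
  have lg : linear g by move=> a x y; apply: (can_inj gf); rewrite linearP !fg.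
  by exists (mklin lg \o i0), (p0 \o f) => x; rewrite /= fg.
pose b := p (1 : A^o, 0); pose a : A := (i b).1.
pose p1 : {linear _ -> P} := p \o pairl \0 idfun.
have pE x : x = ((i x).1 : A) *: b + p1 (i x).2.
  rewrite -{1}(pi x) -linearZ -linearD; congr (p _).
  case: (i x) => c y; rewrite pairlE; congr (_, _) => /=.
    by rewrite addr0 [RHS]mulr1.
  by rewrite scaler0 add0r.
case: (locA a) => -[c ac].
  have lg : linear (fun x => (i x).1 : A^o) by move=> d x y; rewrite linearP.
  pose g := mklin lg.
  have [K [j [ij ej]]] := ker_exists g.
  have lb : linear (fun d : A^o => (d : A) *: b).
    by move=> d x y; rewrite scalerDl scalerA.
  pose q0 : {linear _ -> P} := p1 \- (mklin lb \o ( *:%R c \o (g \o p1))).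
  have [|q qP] := @linear_lift _ _ _ _ j q0 ij.
    move=> y; apply/ej; rewrite /= linearB linearZ /= -/a.
    rewrite [_ *: (a : A^o)](_ : _ = c * g (p1 y) * a) //.
    by rewrite mulrAC [c * a]mulrC ac mul1r subrr.
  have [x|r Kr] := IHn _ (snd \o i \o j) q.
    have g0 : g (j x) = 0 by apply/ej; exists x.
    have p1E : p1 (i (j x)).2 = j x.
      by rewrite [RHS]pE; have -> : (i (j x)).1 = 0 := g0;
        rewrite scale0r add0r.
    apply: ij; rewrite qP.
    rewrite -[LHS]/(p1 (i (j x)).2 - (c * g (p1 (i (j x)).2)) *: b) p1E g0.
    by rewrite mulr0 scale0r subr0.
  exists r.+1; apply: isomorphic_trans (row_succ_iso A r).
  apply: (isomorphic_trans (V := (A^o * K)%type)); last first.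
    by apply: isomorphic_prod Kr; exists idfun; exists idfun.
  apply: isomorphic_sym.
  apply: (isomorphic_bij (f := copair (mklin lb) j)) => [|x].
    apply: linear_inj => -[d x]; rewrite copairE /= => h.
    have gj : g (j x) = 0 by apply/ej; exists x.
    have d0 : d = 0.
      have := congr1 g h; rewrite linearD gj linear0 addr0 linearZ /= -/a => da.
      by have := congr1 ( *%R c) da; rewrite mulr0 mulrCA [c * a]mulrC ac mulr1.
    by congr (_, _) => //; apply: ij; rewrite linear0 -h d0 scale0r add0r.
  have /ej[k kE] : g (x - (c * g x) *: b) = 0.
    rewrite linearB linearZ /= -/a; apply/eqP; rewrite subr_eq0; apply/eqP.
    by rewrite [RHS]mulrAC [c * a]mulrC ac mul1r.
  by exists (c * g x, k); rewrite copairE /= kE addrC subrK.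
have bE : b = p1 (c *: (i b).2).
  have e : (1 - a) *: b = p1 (i b).2.
    by apply/eqP; rewrite scalerBl scale1r subr_eq addrC -pE.
  by rewrite linearZ_LR -e scalerA mulrC ac scale1r.
have li : linear (fun x => (i x).2 + ((i x).1 : A) *: (c *: (i b).2)).
  by move=> d x y; rewrite !linearP /= scalerDl scalerDr !scalerA addrACA.
apply: (IHn _ (mklin li) p1) => x.
by rewrite -[LHS]/(p1
  ((i x).2 + (i x).1 *: (c *: (i b).2))) linearD linearZ_LR -bE addrC -pE.
Qed.

Lemma fg_proj_free (P : lmodType A) : fg_proj P -> free_fin_rank P.
Proof. by move=> /fg_projP[n [i [p /retract_row_free]]]. Qed.

End LocalProjective.

(** * Pullbacks and projective dimension *)

Section ProjDim.
Variable R : comNzRingType.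
Implicit Types E K L M N P Q U V W : lmodType R.

Definition is_pullback E U V W (a : {linear E -> U}) (b : {linear E -> V})
    (f : {linear U -> W}) (g : {linear V -> W}) :=
  [/\ forall e, f (a e) = g (b e),
      forall u v, f u = g v -> exists e, a e = u /\ b e = v
    & forall e, a e = 0 -> b e = 0 -> e = 0].

Lemma pullback_exists U V W (f : {linear U -> W}) (g : {linear V -> W}) :
  exists (E : lmodType R) (a : {linear E -> U}) (b : {linear E -> V}),
    is_pullback a b f g.
Proof.
have [E [j [ij ej]]] := ker_exists ((f \o fst) \- (g \o snd)).
exists E, (fst \o j), (snd \o j); split=> [e|u v fg|e a0 b0].
- have /ej : exists e', j e' = j e by exists e.
  by move=> /eqP; rewrite /= subr_eq0 => /eqP.
- have /ej[e ee] : ((f \o fst) \- (g \o snd)) (u, v) = 0 by rewrite /= fg subrr.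
  by exists e; rewrite /= ee.
- by apply: ij; rewrite linear0; move: a0 b0 => /=; case: (j e) => ? ? /= -> ->.
Qed.

Lemma pullback_sym E U V W (a : {linear E -> U}) (b : {linear E -> V})
    (f : {linear U -> W}) (g : {linear V -> W}) :
  is_pullback a b f g -> is_pullback b a g f.
Proof.
case=> c l z; split=> [e||e b0 a0]; [exact/esym/c| |exact: z].
by move=> u v /esym/l[e [ae be]]; exists e.
Qed.

Lemma pullback_ses E L U V W (a : {linear E -> U}) (b : {linear E -> V})
    (f : {linear U -> W}) (g : {linear V -> W}) (i : {linear L -> U}) :
  is_pullback a b f g -> ses i f ->
  exists l : {linear L -> E}, ses l b /\ forall x, a (l x) = i x.
Proof.
move=> [c li z] sif; have [ii e sf] := sif.
have [|||l lP] := @linear_of_rel _ L E (fun x y => a y = i x /\ b y = 0).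
- by move=> x; apply: li; rewrite linear0 (ses0 _ sif).
- move=> d x y x' y' [ay yb] [ay' yb']; rewrite !linearP ay ay' yb yb'.
  by rewrite scaler0 addr0.
- by move=> y [ay yb]; apply: z; rewrite ?ay ?linear0.
have ab x : a (l x) = i x /\ b (l x) = 0 by apply/lP.
exists l; split=> [|x]; last by case: (ab x).
split=> [|x|v].
- by apply: linear_inj => x lx; apply: ii; rewrite -(ab x).1 lx !linear0.
- split=> [bx|[y <-]]; last by case: (ab y).
  have /e[y yE] : f (a x) = 0 by rewrite c bx linear0.
  by exists y; apply/lP.
- have [u fu] := sf (g v).
  by have [x [_ bx]] := li u v fu; exists x.
Qed.

Lemma pullback_univ E U V W (a : {linear E -> U}) (b : {linear E -> V})
    (f : {linear U -> W}) (g : {linear V -> W}) K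
    (u : {linear K -> U}) (v : {linear K -> V}) :
  is_pullback a b f g -> (forall x, f (u x) = g (v x)) ->
  exists h : {linear K -> E}, forall x, a (h x) = u x /\ b (h x) = v x.
Proof.
move=> [c l z] fg; have [|||h hP] := @linear_of_rel _ K E
  (fun x y => a y = u x /\ b y = v x).
- by move=> x; apply: l.
- by move=> d x y x' y' [ay yb] [ay' yb']; rewrite !linearP ay ay' yb yb'.
- by move=> y [ay yb]; apply: z; rewrite ?ay ?yb linear0.
by exists h => x; apply/hP.
Qed.

Lemma pullback_short E U V W (a : {linear E -> U}) (b : {linear E -> V})
    (f : {linear U -> W}) (g : {linear V -> W}) :
  is_pullback a b f g -> surjective g -> ses (pairl a b) (copair f ( \- g)).
Proof.
move=> [c l z] sg; split=> [|[u v]|w].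
- apply: linear_inj => x; rewrite pairlE => -[]; exact: z.
- rewrite copairE /=; split=> [/eqP|[x [<- <-]]]; last by rewrite c subrr.
  by rewrite subr_eq0 => /eqP/l[e [<- <-]]; exists e.
- have [v vP] := sg (- w); exists (0, v).
  by rewrite copairE /= linear0 add0r vP opprK.
Qed.

(** The pullback of the two covers is an extension of each projective by the kernel of the other
    cover, and both extensions split. *)
Lemma schanuel N P M N' P' (i : {linear N -> P}) (p : {linear P -> M})
    (i' : {linear N' -> P'}) (p' : {linear P' -> M}) :
  ses i p -> ses i' p' -> fg_proj P -> fg_proj P' ->
  isomorphic (N * P')%type (N' * P)%type.
Proof.
move=> s s' fP fP'; have [E [a [b pb]]] := pullback_exists p p'.
have [l [sl _]] := pullback_ses pb s.
have [l' [sl' _]] := pullback_ses (pullback_sym pb) s'.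
apply: isomorphic_trans (ses_proj_split sl fP') _.
exact: isomorphic_sym (ses_proj_split sl' fP).
Qed.

(** Projective dimension at most [n], unrolled one syzygy at a time for induction; [pd_leP] relates
    it to resolutions. *)
Fixpoint pdl (n : nat) M : Prop :=
  if n is n'.+1 then
    exists (N P : lmodType R) (i : {linear N -> P}) (p : {linear P -> M}),
      [/\ fg_proj P, ses i p & pdl n' N]
  else fg_proj M.

Lemma pdl_fin_gen n M : pdl n M -> fin_gen M.
Proof.
case: n => [[]//|n /= [N [P [i [p [[fP _] [_ _ sp] _]]]]]].
exact: fin_gen_surj sp fP.
Qed.

Lemma ses_iso L M N N' (i : {linear L -> M}) (p : {linear M -> N})
    (f : {linear N -> N'}) : bijective f -> ses i p -> ses i (f \o p).
Proof.
move=> [g fK gK] [ii e sp]; split=> // [x|y].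
  split=> [/= fp|/e px]; last by rewrite /= px linear0.
  by apply/e; rewrite -(fK (p x)) fp -[RHS]fK linear0.
by have [x px] := sp (g y); exists x; rewrite /= px gK.
Qed.

Lemma pdl_iso n U V : isomorphic U V -> pdl n U -> pdl n V.
Proof.
case: n => [|n] /= iso; first exact: fg_proj_iso.
move=> [N [P [i [p [fP s pN]]]]]; case: iso => f bf.
by exists N, P, i, (f \o p); split=> //; apply: ses_iso.
Qed.

Lemma pdlS n M : pdl n M -> pdl n.+1 M.
Proof.
elim: n M => [|n IHn] M.
  move=> fM; exists 'rV[R]_0, M, \0, idfun; split=> //; last exact: fg_proj_row.
  split=> [x y _|x|x]; last by exists x.
    by rewrite (thinmx0 x) (thinmx0 y).
  by split=> [/= ->|[y /= <-]] //; exists 0.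
case=> N [P [i [p [fP s pN]]]]; exists N, P, i, p; split=> //; exact: IHn.
Qed.

Lemma pdl_leq n n' M : (n <= n')%N -> pdl n M -> pdl n' M.
Proof.
move=> /subnKC <-; elim: (n' - n)%N => [|k IHk]; first by rewrite addn0.
by rewrite addnS => /IHk/pdlS.
Qed.

Lemma fg_proj_pdl n P : fg_proj P -> pdl n P.
Proof. exact: (@pdl_leq 0). Qed.

Lemma isomorphic_refl U : isomorphic U U.
Proof. by exists idfun; exists idfun. Qed.

Definition prod_map U U' V V' (f : {linear U -> V}) (g : {linear U' -> V'}) :
  {linear (U * U')%type -> (V * V')%type} := pairl (f \o fst) (g \o snd).

Lemma ses_prod_map L M N L' M' N' (i : {linear L -> M}) (p : {linear M -> N})
    (i' : {linear L' -> M'}) (p' : {linear M' -> N'}) :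
  ses i p -> ses i' p' -> ses (prod_map i i') (prod_map p p').
Proof.
move=> [ii e sp] [ii' e' sp']; split.
- by move=> [x x'] [y y'] [/ii -> /ii' ->].
- move=> [x x']; split=> [[/e[y <-] /e'[y' <-]]|[[y y'] [<- <-]]].
    by exists (y, y').
  congr (_, _); first by apply/e; exists y.
  by apply/e'; exists y'.
- move=> [x x']; have [y <-] := sp x; have [y' <-] := sp' x'.
  by exists (y, y').
Qed.

Lemma pdl_prod n U V : pdl n U -> pdl n V -> pdl n (U * V)%type.
Proof.
elim: n U V => [|n IHn] U V; first exact: fg_proj_prod.
move=> [N [P [i [p [fP s pN]]]]] [N' [P' [i' [p' [fP' s' pN']]]]].
exists (N * N')%type, (P * P')%type, (prod_map i i'), (prod_map p p').
split; [exact: fg_proj_prod|exact: ses_prod_map|exact: IHn].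
Qed.

Lemma cover_exists M : fin_gen M ->
  exists n (N : lmodType R) (i : {linear N -> 'rV[R]_n})
    (p : {linear 'rV[R]_n -> M}),
    ses i p.
Proof.
by move=> /fin_genP[n [p sp]]; have [N [i s]] := ses_surj sp; exists n, N, i, p.
Qed.

(** Schanuel's lemma compares [N] with the syzygy that witnesses [pdl]. Closure under summands is a
    hypothesis because its own inductive proof, [pdl_prod_summand], calls this lemma. *)
Lemma pdl_syzygy_of n : (forall U V, pdl n (U * V)%type -> pdl n U) ->
  forall N P M (i : {linear N -> P}) (p : {linear P -> M}),
     ses i p -> fg_proj P -> pdl n.+1 M -> pdl n N.
Proof.
move=> summ N P M i p s fP [N' [P' [i' [p' [fP' s' pN']]]]].
apply: (summ _ P'); apply: pdl_iso (schanuel s' s fP' fP) _.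
by apply: pdl_prod pN' _; apply: fg_proj_pdl.
Qed.

Lemma pdl_prod_summand n U V : pdl n (U * V)%type -> pdl n U.
Proof.
elim: n U V => [|n IHn] U V.
  by apply: fg_proj_summand; exists V; exact: isomorphic_refl.
move=> pUV; have fUV := pdl_fin_gen pUV.
have [|a [K [i [p s]]]] := @cover_exists U.
  by apply: (fin_gen_surj (f := fst)) fUV => u; exists (u, 0).
have [|a' [K' [i' [p' s']]]] := @cover_exists V.
  by apply: (fin_gen_surj (f := snd)) fUV => u; exists (0, u).
exists K, 'rV[R]_a, i, p; split=> //; first exact: fg_proj_row.
apply: (IHn K K'); apply: (pdl_syzygy_of IHn (ses_prod_map s s')) pUV.
by apply: fg_proj_prod; apply: fg_proj_row.
Qed.

Lemma pdl_summand n U V : direct_summand U V -> pdl n V -> pdl n U.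
Proof. by move=> [W /pdl_iso iso] /iso/pdl_prod_summand. Qed.

Lemma pdl_syzygy n N P M (i : {linear N -> P}) (p : {linear P -> M}) :
  ses i p -> fg_proj P -> pdl n M -> pdl n.-1 N.
Proof.
case: n => [|n] s fP; last by apply: pdl_syzygy_of s fP;
  apply: pdl_prod_summand.
move=> fM; apply: (fg_proj_summand (V := P)) => //=.
by exists M; apply: isomorphic_sym; apply: ses_proj_split s fM.
Qed.

(** The map [Q -> N] lifts to [M] by projectivity; together with [P -> L -> M] it covers [M], and
    the three kernels form the new sequence. *)
Lemma horseshoe L M N P Q K K' (i : {linear L -> M}) (p : {linear M -> N})
    (j : {linear K -> P}) (q : {linear P -> L})
    (j' : {linear K' -> Q}) (q' : {linear Q -> N}) :
  ses i p -> ses j q -> ses j' q' -> fg_proj Q ->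
  exists (K'' : lmodType R) (a : {linear K -> K''}) (b : {linear K'' -> K'})
    (j'' : {linear K'' -> (P * Q)%type}) (q'' : {linear (P * Q)%type -> M}),
    ses a b /\ ses j'' q''.
Proof.
move=> s [ij ej sq] [ij' ej' sq'] [_ pQ]; have [ii e sp] := s.
have [h hP] := pQ _ _ p q' sp.
pose c := copair (i \o q) h.
have sc : surjective c.
  move=> m; have [y yE] := sq' (p m).
  have /e[l il] : p (m - h y) = 0 by rewrite linearB hP yE subrr.
  have [x xE] := sq l; exists (x, y).
  by rewrite copairE /= xE il subrK.
have [K'' [j'' s'']] := ses_surj sc; have [ij'' ej'' _] := s''.
have pc x : p (c x) = q' x.2.
  by rewrite copairE linearD hP /= (ses0 _ s) add0r.
have [|a aP] := linear_lift (f := pairl j \0) ij''.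
  move=> x; apply/ej''; rewrite copairE /= linear0 addr0.
  by rewrite (proj2 (ej (j x))) ?linear0 //; exists x.
have [|b bP] := linear_lift (f := snd \o j'') ij'.
  move=> x; apply/ej'; rewrite /= -pc (proj2 (ej'' (j'' x))) ?linear0 //.
  by exists x.
exists K'', a, b, j'', c; split=> //; split=> [|x|y].
- apply: linear_inj => x ax; apply: ij; have /(congr1 fst) := aP x.
  by rewrite ax !linear0.
- split=> [bx|[y <-]]; last by apply: ij'; rewrite bP /= aP linear0.
  have x2 : (j'' x).2 = 0 by have := bP x; rewrite bx linear0.
  have cx : c (j'' x) = 0 by apply/ej''; exists x.
  have /ej[y yE] : q (j'' x).1 = 0.
    by apply: ii; rewrite linear0 -cx copairE x2 linear0 addr0.
  exists y; apply: ij''; rewrite aP pairlE /= yE -x2; by case: (j'' x).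
- have /e[l il] : p (h (j' y)) = 0.
    by rewrite hP; apply/ej'; exists y.
  have [x xE] := sq l.
  have /ej''[z zE] : c (- x, j' y) = 0.
    by rewrite copairE /= !linearN /= xE il addNr.
  by exists z; apply: ij'; rewrite bP /= zE.
Qed.

Lemma pdl_ext n L M N (i : {linear L -> M}) (p : {linear M -> N}) :
  ses i p -> pdl n L -> pdl n N -> pdl n M.
Proof.
elim: n L M N i p => [|n IHn] L M N i p s.
  move=> fL fN; apply: fg_proj_iso (ses_proj_split s fN) _.
  exact: fg_proj_prod.
move=> [K [P [j [q [fP sj pK]]]]] [K' [Q [j' [q' [fQ sj' pK']]]]].
have [K'' [a [b [j'' [q'' [sab s'']]]]]] := horseshoe s sj sj' fQ.
exists K'', (P * Q)%type, j'', q''; split=> //; first exact: fg_proj_prod.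
exact: IHn sab pK pK'.
Qed.

(** From left to right, the first term of the resolution is split off and the rest resolves the
    kernel; from right to left, the sequences are spliced and padded with zeros. *)
Lemma pd_leP n M : pd_le n M <-> pdl n M.
Proof.
split.
  elim: n M => [|n IHn] M [P [d [e [fP se ex0 ex Pz]]]].
    have fP0 : fg_proj (P 0%N) := fP 0%N.
    apply: fg_proj_iso fP0; apply: (isomorphic_bij (f := e)) => //.
    apply: linear_inj => x /ex0[y <-].
    by rewrite (Pz 1%N isT y) linear0.
  have [N [i [ii ei]]] := ker_exists e.
  exists N, (P 0%N), i, e; split=> //.
  have [|d0 d0P] := linear_lift (f := d 0%N) ii.
    by move=> w; apply/ei/ex0; exists w.
  apply: IHn; exists (fun k => P k.+1), (fun k => d k.+1), d0; split=> //.
  - move=> x; have /ex0[y yE] : e (i x) = 0 by apply/ei; exists x.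
    by exists y; apply: ii; rewrite d0P.
  - move=> y; split=> [dy|/ex dy]; last by apply: ii; rewrite d0P linear0.
    by apply/ex; rewrite -d0P dy linear0.
  - by move=> k nk; apply: Pz.
elim: n M => [|n IHn] M.
  move=> fM; pose P k : lmodType R := if k is 0 then M else 'rV[R]_0.
  exists P, (fun k => \0 : {linear P k.+1 -> P k}), idfun; split=> //.
  - by case=> [|k]; [exact: fM|exact: fg_proj_row].
  - by move=> y; exists y.
  - by move=> y; split=> [/= ->|[x /= <-]] //; exists 0.
  - move=> k y /=; split=> // _; exists 0; rewrite /= [RHS]thinmx0 //.
  - by case=> // k _ x; rewrite [LHS]thinmx0.
move=> [N [Q [i [p [fQ [ii ei sp] /IHn[P [d [e [fP se ex0 ex Pz]]]]]]]]].
pose P' k : lmodType R := if k is k'.+1 then P k' else Q.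
pose d' k : {linear P' k.+1 -> P' k} :=
  match k with 0 => i \o e | k'.+1 => d k' end.
exists P', d', p; split=> //.
- by case.
- move=> y; split=> [/ei[x <-]|[x /= <-]].
    by have [z <-] := se x; exists z.
  by apply/ei; exists (e x).
- case=> [|k] y /=; last exact: ex.
  split=> [iey|/ex0 ->]; last by rewrite linear0.
  by apply/ex0; apply: ii; rewrite iey linear0.
- by case=> // k nk x; apply: Pz.
Qed.

End ProjDim.

(** * Stably trivial scalars, resolving subcategories and cosyzygies of the ring *)

Section Subcategories.
Variables (R : comNzRingType).
Implicit Types (E G K L M N P Q T U V W : lmodType R) (X : subcat R).

(* Multiplication by [a] on [M] is stably zero; for all powers of [m] this is
   local freeness on the punctured spectrum, see [locally_free_puncturedP]. *)
Definition factors (a : R) M :=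
  exists P (f : {linear M -> P}) (g : {linear P -> M}),
    fg_proj P /\ forall x, g (f x) = a *: x.

Lemma factorsM a b M : factors a M -> factors (b * a) M.
Proof.
move=> [P [f [g [fP fg]]]]; exists P, f, (b \*: g); split=> // x.
by rewrite -scalerA -fg.
Qed.

Lemma factors_retract a U V (i : {linear U -> V}) (p : {linear V -> U}) :
  (forall x, p (i x) = x) -> factors a V -> factors a U.
Proof.
move=> pi [P [f [g [fP fg]]]]; exists P, (f \o i), (p \o g); split=> // x /=.
by rewrite fg linearZ_LR pi.
Qed.

Lemma factors_proj a P : fg_proj P -> factors a P.
Proof. by move=> fP; exists P, idfun, (a \*: idfun). Qed.

(** With [h] lifting [g], the map [b - h f p] lands in [L], where multiplication by [a] factors over
    [Q]; the remaining term factors over [P]. *)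
Lemma factors_ext a b L M N (i : {linear L -> M}) (p : {linear M -> N}) :
  ses i p -> factors a L -> factors b N -> factors (a * b) M.
Proof.
move=> s [Q [f' [g' [fQ fg']]]] [P [f [g [fP fg]]]]; have [ii e sp] := s.
have [_ pP] := fP; have [h hP] := pP _ _ p g sp.
have [|k kP] := linear_lift (f := (b \*: idfun) \- (h \o f \o p)) ii.
  by move=> x; apply/e; rewrite linearB linearZ_LR /= hP fg subrr.
exists (P * Q)%type, (pairl (f \o p) (f' \o k)), (copair (a \*: h) (i \o g')).
split=> [|x]; first exact: fg_proj_prod.
rewrite copairE /= fg' linearZ_LR kP /= -scalerA -scalerDr; congr (_ *: _).
by rewrite addrC subrK.
Qed.

(** With [h] lifting [g], the map [a - h f p] sends [P] into [N] and restricts to [a] on [N]. *)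
Lemma factors_syzygy a N P M (i : {linear N -> P}) (p : {linear P -> M}) :
  ses i p -> fg_proj P -> factors a M -> factors a N.
Proof.
move=> s fP [Q [f [g [[_ pQ] fg]]]]; have [ii e sp] := s.
have [h hP] := pQ _ _ p g sp.
have [|k kP] := linear_lift (f := (a \*: idfun) \- (h \o f \o p)) ii.
  by move=> x; apply/e; rewrite linearB linearZ_LR /= hP fg subrr.
exists P, i, k; split=> // x; apply: ii.
by rewrite kP /= (ses0 _ s) !linear0 addr0 linearZ_LR.
Qed.

(** The map [a - i g f] vanishes on [T], so it descends to [T' -> G]; followed by [q] it is
    multiplication by [a]. *)
Lemma factors_cosyzygy (a : R) T G T' P (i : {linear T -> G})
  (q : {linear G -> T'})
    (f : {linear G -> P}) (g : {linear P -> T}) :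
  ses i q -> fg_proj G -> (forall x, g (f (i x)) = a *: x) -> factors a T'.
Proof.
move=> s fG gf; have [ii e sq] := s.
have [|h hP] := linear_factor (f := (a \*: idfun) \- (i \o g \o f)) sq.
  by move=> u /e[x <-] /=; rewrite gf linearZ_LR subrr.
exists G, h, q; split=> // y; have [u <-] := sq y.
by rewrite hP linearB linearZ_LR /= (ses0 _ s) subr0.
Qed.

Section Ideal.
Variable m : idealr R.

Definition stably_torsion M := forall x, x \in m -> exists s,
  factors (x ^+ s) M.

(* The modules of [PD_0^n], see [PD0nP]. *)
Definition fpdt n M := pdl n M /\ stably_torsion M.

Lemma summand_closed_iso X U V : summand_closed X -> isomorphic U V -> X U ->
  X V.
Proof.
move=> sX iso XU; apply: sX XU _; apply/summand_retract.
have [f [g fK gK]] := isomorphic_sym iso.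
have lg : linear g by move=> a x y; apply: (can_inj fK); rewrite linearP !gK.
by exists f, (mklin lg).
Qed.

Lemma summand_prodl U V : direct_summand U (U * V)%type.
Proof. by exists V; apply: isomorphic_refl. Qed.

Lemma summand_prodr U V : direct_summand V (U * V)%type.
Proof. by apply/summand_retract; exists (pairl \0 idfun), snd. Qed.

Lemma resolving_fpdt n : resolving (fpdt n).
Proof.
split; first split.
- by move=> M [/pdl_fin_gen].
- move=> M N [pM sM] NM; split; first exact: pdl_summand NM pM.
  have [i [p pi]] := (summand_retract N M).1 NM.
  by move=> x /sM[s fs]; exists s; apply: factors_retract pi fs.
- move=> L M N [i [p s]] [pL sL] [pN sN]; split; first exact: pdl_ext s pL pN.
  move=> x xm; have [a fa] := sL x xm; have [b fb] := sN x xm.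
  by exists (a + b)%N; rewrite exprD; apply: factors_ext s fa fb.
- move=> P fP pP; have fgP : fg_proj P by [].
  split; first exact: fg_proj_pdl.
  by move=> x _; exists 0%N; apply: factors_proj.
- move=> N P M [i [p s]] fP pP [pM sM]; have fgP : fg_proj P by [].
  split; first by apply: pdl_leq (leq_pred n) _; apply: pdl_syzygy s fgP pM.
  by move=> x /sM[a fa]; exists a; apply: factors_syzygy s fgP fa.
Qed.

(** The pullback of [p] along a free cover of [N] is an extension of [M] by a syzygy of [N], so it
    lies in [X]; it also splits as [L] plus a free module. *)
Lemma resolving_ker_epi X L M N (i : {linear L -> M}) (p : {linear M -> N}) :
  resolving X -> ses i p -> X M -> X N -> X L.
Proof.
move=> [[fX sX eX] pX zX] s XM XN.
have [n [K [j [q t]]]] := cover_exists (fX _ XN).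
have [fP pP] := fg_proj_row R n.
have [E [a [b pb]]] := pullback_exists p q.
have [l [sl _]] := pullback_ses pb s.
have [l' [sl' _]] := pullback_ses (pullback_sym pb) t.
have XK : X K by apply: zX fP pP XN; apply: ses_short t.
have XE : X E := eX _ _ _ (ses_short sl') XK XM.
apply: sX XE _; exists 'rV[R]_n; apply: isomorphic_sym.
exact: ses_proj_split sl (fg_proj_row R n).
Qed.

Lemma ext_closed_proj X P : extension_closed X -> X R^o -> fg_proj P -> X P.
Proof.
move=> [fX sX eX] XR /fg_projP[n [i [p pi]]].
have XP Q : direct_summand P Q -> X Q -> X P by move=> PQ XQ; apply: sX XQ PQ.
apply: (XP 'rV[R]_n); first by apply/summand_retract; exists i, p.
elim: n {i p pi XP} => [|n IHn].
  apply: sX XR _; apply/summand_retract; exists \0, \0 => x.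
  by rewrite [RHS]thinmx0.
apply: (summand_closed_iso sX (row_succ_iso R n)).
exact: eX (ses_short (ses_prod _ _)) XR IHn.
Qed.

Lemma resolving_proj X P : resolving X -> fg_proj P -> X P.
Proof. by case=> _ pX _ [fP pP]; apply: pX. Qed.

(* [cosyz j T] says that [T] is the [(j + 1)]-st cosyzygy of [R] along the dual
   of a free resolution of the residue field; this is what we use of
   [Tr Omega^j k].  In degree [0] the forms on [R] that extend are exactly those
   in [m]. *)
Fixpoint cosyz (j : nat) T : Prop :=
  if j is j'.+1 then
    exists T' G (i : {linear T' -> G}) (q : {linear G -> T}),
      [/\ fg_proj G, ses i q, forms_extend i & cosyz j' T']
  else exists G (i : {linear R^o -> G}) (q : {linear G -> T}),
    [/\ fg_proj G, ses i q
      & forall c : R, (exists v : {linear G -> R^o}, v (i 1) = c) <-> c \in m].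

Lemma cosyz_pdl j T : cosyz j T -> pdl j.+1 T.
Proof.
elim: j T => [|j IHj] T /=.
  move=> [G [i [q [fG s e]]]]; exists R^o, G, i, q; split=> //.
  exact: fg_proj_regular.
move=> [T' [G [i [q [fG s e /IHj p]]]]]; exists T', G, i, q; split=> //.
Qed.

Lemma linear_regularE V (v : {linear R^o -> V}) (c : R^o) :
  v c = (c : R) *: v 1.
Proof. by rewrite -linearZ_LR; congr (v _); rewrite [RHS]mulr1. Qed.

(** A form on [G] that restricts to [x] along [R -> G] starts the induction. Afterwards maps from
    [T'] to projectives extend over [G], and [factors_cosyzygy] passes to the cokernel. *)
Lemma cosyz_factors j T x : x \in m -> cosyz j T -> factors x T.
Proof.
move=> xm; elim: j T => [|j IHj] T /=.
  move=> [G [i [q [fG s e]]]]; have [v vx] := (e x).2 xm.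
  apply: (factors_cosyzygy (f := v) (g := idfun) s fG) => c.
  rewrite -[LHS]/((v \o i) c) (linear_regularE (v \o i) c) /= vx.
  by rewrite [LHS]mulrC.
move=> [T' [G [i [q [fG s e /IHj[P [f [g [fP fg]]]]]]]]].
have [v vP] := forms_extend_proj f e fP.
by apply: (factors_cosyzygy (f := v) (g := g) s fG) => y; rewrite vP fg.
Qed.

Lemma cosyz_fpdt j T : cosyz j T -> fpdt j.+1 T.
Proof.
move=> c; split; first exact: cosyz_pdl.
by move=> x xm; exists 1%N; apply: cosyz_factors c.
Qed.

(** If the cosyzygy of degree 0 were projective, [R -> G] would split and 1 would be among the forms
    that extend, that is, in [m]. Higher degrees reduce to this by taking syzygies. *)
Lemma cosyz_not_pdl j T : cosyz j T -> ~ pdl j T.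
Proof.
elim: j T => [|j IHj] T /=.
  move=> [G [i [q [fG s e]]]] [_ pT]; have [ii ei sq] := s.
  have [t tP] := pT _ _ q idfun sq.
  have [|r rP] := linear_lift (f := idfun \- (t \o q)) ii.
    by move=> w; apply/ei; rewrite linearB /= tP subrr.
  suff /e : exists v : {linear G -> R^o}, v (i 1) = 1 by rewrite idealr1.
  by exists r; apply: ii; rewrite rP /= (ses0 _ s) linear0 subr0.
move=> [T' [G [i [q [fG s e /IHj np]]]]] pT; apply: np.
exact: (pdl_syzygy (n := j.+1) s fG pT).
Qed.

End Ideal.
End Subcategories.

(** * Noetherian modules *)

Section Noetherian.
Variable R : comNzRingType.
Implicit Types (K L M N P U V W : lmodType R).

Definition submodule V (J : V -> Prop) :=
  J 0 /\ forall a x y, J x -> J y -> J (a *: x + y).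

Lemma submodule_sum V (J : V -> Prop) (I : Type) (r : seq I) (F : I -> V) :
  submodule J -> (forall i, J (F i)) -> J (\sum_(i <- r) F i).
Proof.
move=> [J0 JD] JF; apply: big_ind => // x y Jx Jy.
by rewrite -[x]scale1r; apply: JD.
Qed.

Lemma submoduleZ V (J : V -> Prop) a x : submodule J -> J x -> J (a *: x).
Proof. by move=> [J0 JD] Jx; rewrite -[_ *: _]addr0; apply: JD. Qed.

Lemma submoduleD V (J : V -> Prop) x y : submodule J -> J x -> J y -> J (x + y).
Proof. by move=> [J0 JD] Jx Jy; rewrite -[x]scale1r; apply: JD. Qed.

Lemma submoduleB V (J : V -> Prop) x y : submodule J -> J x -> J y -> J (x - y).
Proof. by move=> [J0 JD] Jx Jy; rewrite addrC -scaleN1r; apply: JD. Qed.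

Definition noeth_mod V :=
  forall U (i : {linear U -> V}), injective i -> fin_gen U.

Lemma submodule_exists V (J : V -> Prop) : submodule J ->
  exists U (i : {linear U -> V}), injective i /\ forall x, J x <-> exists u,
    i u = x.
Proof.
move=> [J0 JD]; pose S : {pred V} := fun x => `[< J x >].
have Sc : GRing.submod_closed S.
  split=> [|a x y /asboolP Jx /asboolP Jy]; apply/asboolP => //; exact: JD.
pose SS : submodClosed V :=
  HB.pack (S : V -> bool) (GRing.isSubmodClosed.Build R V S
    (GRing.submod_closed_semi Sc)).
have lv : linear (@submod_val _ _ SS) by [].
exists (submod SS), (mklin lv); split=> [x y /val_inj //|x].
split=> [Jx | [y <-]]; last by case: y => y yS; apply/asboolP.
have xS : x \in SS by apply/asboolP.
by exists (Submod xS).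
Qed.

Lemma noeth_mod_gen V (J : V -> Prop) : noeth_mod V -> submodule J ->
  exists n (g : 'I_n -> V), (forall i, J (g i)) /\
    forall x, J x -> exists c : 'I_n -> R, x = \sum_i c i *: g i.
Proof.
move=> nV /submodule_exists[U [i [ii JP]]].
have /fin_genP[n [e se]] := nV _ _ ii.
exists n, (fun k => i (e (delta_mx 0 k))); split=> [k|x /JP[u <-]].
  by apply/JP; exists (e (delta_mx 0 k)).
have [y <-] := se u; exists (fun k => y 0 k).
by rewrite -[LHS]/((i \o e) y) linear_rowE.
Qed.

(** The family is indexed by a type so that a sigma type can carry side conditions. Without a
    maximal member there is a strictly ascending chain, yet finitely many generators of its union
    already lie in one member. *)
Lemma noeth_mod_max V (T : Type) (J : T -> V -> Prop) : noeth_mod V ->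
  (forall t, submodule (J t)) -> T ->
  exists t, forall t', (forall x, J t x -> J t' x) -> forall x, J t' x -> J t x.
Proof.
move=> nV sJ t0; apply: contrapT => nomax.
have next t : exists t', (forall x, J t x -> J t' x) /\ exists x, J t' x /\
  ~ J t x.
  apply: contrapT => nt; apply: nomax; exists t => t' tt' x Jx.
  by apply: contrapT => nx; apply: nt; exists t'; split=> //; exists x.
pose f t := sval (cid (next t)).
have f1 t x : J t x -> J (f t) x by move: x; exact: (svalP (cid (next t))).1.
have f2 t : exists x, J (f t) x /\ ~ J t x := (svalP (cid (next t))).2.
pose s k := iter k f t0.
have s_le j k x : (j <= k)%N -> J (s j) x -> J (s k) x.
  move=> /subnKC <-; elim: (k - j)%N => [|d IHd]; first by rewrite addn0.
  by rewrite addnS => /IHd/f1.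
have sU : submodule (fun x => exists k, J (s k) x).
  split=> [|a x y [k Jx] [l Jy]]; first by exists 0%N; case: (sJ (s 0%N)).
  exists (maxn k l); apply: (sJ _).2.
    exact: s_le (leq_maxl _ _) Jx.
  exact: s_le (leq_maxr _ _) Jy.
have [n [g [gJ gen]]] := noeth_mod_gen nV sU.
have [k0 kg] : exists k0, forall i, J (s k0) (g i).
  pose h i := sval (cid (gJ i)); exists (\max_i h i) => i.
  by apply: s_le (leq_bigmax i) _; apply: (svalP (cid (gJ i))).
have [x [Jx nJx]] := f2 (s k0).
have [|c xE] := gen x; first by exists k0.+1.
apply: nJx; rewrite xE; apply: submodule_sum => // i.
exact: submoduleZ.
Qed.

Lemma noeth_mod_inj U V (i : {linear U -> V}) :
  injective i -> noeth_mod V -> noeth_mod U.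
Proof. by move=> ii nV W j ij; apply: (nV _ (i \o j)); apply: inj_comp. Qed.

Lemma noeth_mod_ext L M N (i : {linear L -> M}) (p : {linear M -> N}) :
  ses i p -> noeth_mod L -> noeth_mod N -> noeth_mod M.
Proof.
move=> [ii e sp] nL nN U k ik.
have [K [j [ij ej]]] := ker_exists (p \o k).
have [C [q s]] := ses_inj ij; have [_ eq sq] := s.
have [|h hP] := linear_lift (f := k \o j) ii.
  by move=> w; apply/e/ej; exists w.
have [|h' h'P] := linear_factor (f := p \o k) sq.
  by move=> u /eq[x <-]; apply/ej; exists x.
apply: (fin_gen_ext s).
  apply: (nL _ h); apply: linear_inj => x hx; apply: ij; apply: ik.
  by rewrite !linear0 -[LHS]/((k \o j) x) -hP hx linear0.
apply: (nN _ h'); apply: linear_inj => c; have [u <-] := sq c.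
by rewrite h'P => /ej[x <-]; rewrite (ses0 _ s).
Qed.

Hypothesis noethR : noetherian R.

Lemma noeth_regular : noeth_mod R^o.
Proof.
move=> U i ii; have fI := noethR (im_pred i).
have lv : linear (@submod_val _ _ (im_pred i)) by [].
have [|h hP] := linear_lift (f := mklin lv) ii.
  by case=> y yS; apply/asboolP.
apply: (fin_gen_surj (f := h)) fI => u.
have yS : i u \in im_pred i by apply/asboolP; exists u.
by exists (Submod yS); apply: ii; rewrite hP.
Qed.

Lemma noeth_row n : noeth_mod 'rV[R]_n.
Proof.
elim: n => [|n IHn].
  move=> U i ii; apply/fin_genP; exists 0%N, \0 => u; exists 0.
  by apply: ii; rewrite (thinmx0 (i u)) !linear0.
have [f [g fK gK]] := isomorphic_sym (row_succ_iso R n).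
apply: (noeth_mod_inj (can_inj fK)).
exact: noeth_mod_ext (ses_prod _ _) noeth_regular IHn.
Qed.

Lemma ideal_gen (m : idealr R) : exists n (g : 'I_n -> R),
  (forall i, g i \in m) /\
  forall x, x \in m -> exists c : 'I_n -> R, x = \sum_i c i * g i.
Proof.
apply: (@noeth_mod_gen R^o (fun x : R => x \in m) noeth_regular).
by split=> [|a x y xm ym]; rewrite ?rpred0 // rpredD // idealMr.
Qed.

End Noetherian.

(** * Dual modules and forms that extend *)

Section Forms.
Variable R : comNzRingType.
Implicit Types (E G K L M N P T U V W : lmodType R).

Fact dual_form_subproof V (h : dual V) : linear (submod_val h).
Proof. by case: h => h /= /asboolP. Qed.

Definition dual_form V (h : dual V) : {linear V -> R^o} :=
  mklin (dual_form_subproof h).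

Fact form_dual_subproof V (u : {linear V -> R^o}) :
  (u : V -> R^o) \in @linear_pred R V.
Proof. by apply/asboolP; apply: linearP. Qed.

Definition form_dual V (u : {linear V -> R^o}) : dual V :=
  Submod (form_dual_subproof u).

Lemma dual_formP V (a : R) (g h : dual V) x :
  dual_form (a *: g + h) x = a * dual_form g x + dual_form h x.
Proof. by []. Qed.

Lemma dual_ext V (g h : dual V) :
  (forall x, dual_form g x = dual_form h x) -> g = h.
Proof. by move=> e; apply: val_inj; apply/funext. Qed.

(** For [0 -> N -> V -> M -> 0] with [V] projective, [dual N] modulo this submodule is
    [Ext^1(M, R)]. *)
Definition ext_forms N V (i : {linear N -> V}) (h : dual N) :=
  exists v : {linear V -> R^o}, forall x, v (i x) = dual_form h x.

Lemma ext_forms_all N V (i : {linear N -> V}) :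
  (forall h, ext_forms i h) -> forms_extend i.
Proof. by move=> e u; have [v vP] := e (form_dual u); exists v. Qed.

Lemma submodule_ext_forms N V (i : {linear N -> V}) : submodule (ext_forms i).
Proof.
split=> [|a g h [u uP] [v vP]].
  by exists \0.
by exists ((a \*: u) \+ v) => x; rewrite dual_formP -uP -vP.
Qed.

(** A form is determined by its values on generators, so the dual embeds in a free module. *)
Lemma noeth_dual V : noetherian R -> fin_gen V -> noeth_mod (dual V).
Proof.
move=> nR /fin_genP[n [e se]].
have lf : linear (fun h :
  dual V => \row_i (dual_form h (e (delta_mx 0 i)) : R)).
  by move=> a g h; apply/rowP => i; rewrite !mxE dual_formP.
apply: (noeth_mod_inj (i := mklin lf) _ (@noeth_row _ nR n)).
move=> g h /rowP gh; apply: dual_ext => x; have [y <-] := se x.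
apply: (linear_row_ext (f := dual_form g \o e) (g := dual_form h \o e)) => i.
by have := gh i; rewrite !mxE.
Qed.

End Forms.

(** * Submodules of finite colength *)

Section Lengths.
Variables (R : comNzRingType) (m : idealr R).
Hypothesis noethR : noetherian R.
Variable V : lmodType R.

(* [V / U] has a filtration with [l] successive quotients that are cyclic and
   killed by [m]. *)
Fixpoint colength (l : nat) (U : V -> Prop) : Prop :=
  if l is l'.+1 then
    exists2 u, forall x, x \in m -> U (x *: u)
      & colength l' (fun v => exists c, U (v - c *: u))
  else forall v, U v.

(** The generators of [m] are treated one by one: the current element is multiplied by the highest
    power of the generator that keeps it outside [U]. Earlier generators still send the product into
    [U]. *)
Lemma socle_mod (U : V -> Prop) u : submodule U -> ~ U u ->
  (forall v x, x \in m -> exists s, U (x ^+ s *: v)) ->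
  exists2 w, ~ U w & forall x, x \in m -> U (x *: w).
Proof.
move=> sU nu tors; have [n [g [gm gen]]] := ideal_gen noethR m.
have [w nw wP] : exists2 w, ~ U w & forall i : 'I_n, i \in enum 'I_n ->
  U (g i *: w).
  elim: (enum 'I_n) => [|i s [w nw wP]]; first by exists u.
  have ex : exists a, `[< U (g i ^+ a *: w) >].
    by have [a Ua] := tors w _ (gm i); exists a; apply/asboolP.
  case: (ex_minnP ex) => -[|a] /asboolP Ua amin; first by rewrite scale1r in Ua.
  exists (g i ^+ a *: w).
    by move=> /asboolP/amin; rewrite ltnn.
  move=> j; rewrite inE => /orP[/eqP ->|/wP Uj];
    first by rewrite scalerA -exprS.
  by rewrite scalerA mulrC -scalerA; apply: submoduleZ.
exists w => // x /gen[c ->]; rewrite scaler_suml; apply: submodule_sum => // i.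
by rewrite -scalerA; apply: submoduleZ => //; apply: wP; rewrite mem_enum.
Qed.

Lemma submodule_adjoin (U : V -> Prop) u : submodule U ->
  submodule (fun v => exists c, U (v - c *: u)).
Proof.
move=> sU; split=> [|a x y [c Uc] [d Ud]].
  by exists 0; rewrite scale0r subr0; case: sU.
exists (a * c + d); rewrite scalerDl -scalerA opprD addrACA -scalerBr.
by apply: sU.2.
Qed.

Lemma adjoin_sub (U : V -> Prop) u v : U v -> exists c, U (v - c *: u).
Proof. by exists 0; rewrite scale0r subr0. Qed.

(** Noetherian induction: a submodule maximal among those of infinite colength can be enlarged by a
    socle element, and the enlarged one has finite colength. *)
Lemma colength_exists (U : V -> Prop) : noeth_mod V -> submodule U ->
  (forall v x, x \in m -> exists s, U (x ^+ s *: v)) -> exists l, colength l U.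
Proof.
move=> nV sU tors; apply: contrapT => nU.
pose T := {U' : V -> Prop | [/\ submodule U', forall v, U v -> U' v
  & ~ exists l, colength l U']}.
have t0 : T by exists U.
have [U' [sU' UU' nl] max] : exists2 U' : V -> Prop,
    [/\ submodule U', forall v, U v -> U' v & ~ exists l, colength l U']
    & forall t : T, (forall x, U' x -> sval t x) -> forall x, sval t x -> U' x.
  have [|[U' U'P] max] := @noeth_mod_max _ _ T (@sval _ _) nV _ t0.
    by case=> ? [].
  by exists U'.
have [u nu] : exists u, ~ U' u.
  by apply: contrapT => nu; apply: nl; exists 0%N => v; apply: contrapT => nv;
    apply: nu; exists v.
have [w nw mw] : exists2 w, ~ U' w & forall x, x \in m -> U' (x *: w).
  apply: socle_mod sU' nu _ => v x xm; have [s Us] := tors v x xm.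
  by exists s; apply: UU'.
pose U'' v := exists c, U' (v - c *: w).
have [[l cl]|nl''] := pselect (exists l, colength l U'').
  by apply: nl; exists l.+1; exists w.
have t'' : [/\ submodule U'', forall v, U v -> U'' v & ~ exists l,
  colength l U''].
  split=> // [|v Uv]; first exact: submodule_adjoin.
  exact: adjoin_sub (UU' v Uv).
apply: nw; apply: (max (exist _ U'' t'')) => [x Ux|];
  first exact: adjoin_sub Ux.
by exists 1; rewrite scale1r subrr; case: sU'.
Qed.

End Lengths.

(** * Killing [Ext] one socle element at a time *)

Section KillExt.
Variables (R : comNzRingType) (m : idealr R).
Hypothesis noethR : noetherian R.
Hypothesis unit_notin : forall x, x \notin m -> exists y, x * y = 1.
Implicit Types (E G K L M N P T U V W : lmodType R) (X : subcat R).

(* [Ext^i(M, R) = 0] for [0 < i <= j]. *)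
Fixpoint ext_vanish (j : nat) M : Prop :=
  if j is j'.+1 then
    exists N P (i : {linear N -> P}) (p : {linear P -> M}),
      [/\ fg_proj P, ses i p, forms_extend i & ext_vanish j' N]
  else True.

(* [Ext^i(M, R) = 0] for [0 < i <= j], and [Ext^(j+1)(M, R)] has length at most
   [l]. *)
Fixpoint ext_length (j l : nat) M : Prop :=
  if j is j'.+1 then
    exists N P (i : {linear N -> P}) (p : {linear P -> M}),
      [/\ fg_proj P, ses i p, forms_extend i & ext_length j' l N]
  else exists N P (i : {linear N -> P}) (p : {linear P -> M}),
    [/\ fg_proj P, ses i p & colength m l (ext_forms i)].

Lemma ext_length0 j M : ext_length j 0 M -> ext_vanish j.+1 M.
Proof.
elim: j M => [|j IHj] M.
  move=> [N [P [i [p [fP s c]]]]]; exists N, P, i, p; split=> //.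
  exact: ext_forms_all.
by move=> [N [P [i [p [fP s c /IHj e]]]]]; exists N, P, i, p.
Qed.

(** Some power of each [x] in [m] factors through a projective on [M] and hence kills [Ext^1], which
    makes the colength finite. Higher degrees pass to the syzygy. *)
Lemma ext_length_exists j n M : ext_vanish j M -> fpdt m n M ->
  exists l, ext_length j l M.
Proof.
elim: j n M => [|j IHj] n M.
  move=> _ [pM tM]; have [a [N [i [p s]]]] := cover_exists (pdl_fin_gen pM).
  have fP := fg_proj_row R a.
  have fN : fin_gen N.
    by case: s => ii _ _; apply: noeth_row ii.
  have [|l lP] := @colength_exists _ m noethR _ (ext_forms i)
      (noeth_dual noethR fN) (submodule_ext_forms i).
    move=> h x /tM[s' [Q [f [g [fQ fg]]]]]; exists s'.
    have [ii e sp] := s; have [_ pQ] := fQ; have [k kP] := pQ _ _ p g sp.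
    (* The map [r] sends the free cover to [N] and restricts to [x ^+ s'] on [N], so [h \o r]
       extends [x ^+ s' *: h]. *)
    have [|r rP] := linear_lift (f := (x ^+ s' \*: idfun) \- (k \o f \o p)) ii.
      by move=> w; apply/e; rewrite linearB linearZ_LR /= kP fg subrr.
    exists (dual_form h \o r) => w; rewrite -[RHS]/(x ^+ s' *: dual_form h w).
    rewrite -linearZ_LR /=; congr (dual_form h _); apply: ii.
    by rewrite rP /= (ses0 _ s) !linear0 addr0 linearZ_LR.
  by exists l; exists N, 'rV[R]_a, i, p.
move=> [N [P [i [p [fP s e /IHj IH]]]]] fM.
have fN : fpdt m n N.
  have [_ _ z] := resolving_fpdt m n.
  by case: fP => f1 f2; apply: z f1 f2 fM; apply: ses_short s.
by have [l lP] := IH n fN; exists l; exists N, P, i, p.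
Qed.

(** The syzygy is projective by induction; its identity map then extends over [P] and splits the
    sequence. *)
Lemma ext_vanish_proj n M : ext_vanish n M -> pdl n M -> fg_proj M.
Proof.
elim: n M => [|n IHn] M //= [N [P [i [p [fP s e vN]]]]] pM.
have fN : fg_proj N by apply: IHn vN (pdl_syzygy (n := n.+1) s fP pM).
have [r rP] := forms_extend_proj idfun e fN.
have iso := ses_retract_iso s rP.
apply: (fg_proj_summand (V := (N * M)%type)); first exact: summand_prodr.
exact: fg_proj_iso (isomorphic_sym iso) fP.
Qed.

(* The map [phi : M -> T] corresponds to a socle element of [Ext^(j+1)(M, R)],
   and [M'] is the kernel of [M + G -> T]. *)
Definition socle_kill j l M T :=
  exists K G (k : {linear K -> G}) (q : {linear G -> T})
    M' (b : {linear M' -> M}) (c : {linear M' -> G}) (phi : {linear M -> T})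
    (h : {linear K -> M'}),
  [/\ fg_proj G, ses k q, is_pullback b c phi q
    & [/\ ses h b, forall x, c (h x) = k x,
          forall u : {linear M' -> R^o}, exists v : {linear G -> R^o},
            forall x, v (k x) = u (h x)
        & ext_length j l M']].

(** The socle element is the class of a form [u] on [N]. Since [m] times [u] extends over [P], so
    does [k \o u], and this induces [phi : M -> T]. The pullback [M'] is [P * R] modulo [N] embedded
    by [(i, - u)], which makes [u] extend. *)
Lemma socle_kill0 l M T : cosyz m 0 T -> ext_length 0 l.+1 M ->
  ext_length 0 l M \/ socle_kill 0 l M T.
Proof.
move=> [G [k [q [fG sG km]]]] [N [P [i [p [fP s [u um cl]]]]]].
have sub := submodule_ext_forms i.
(* If [u] already extends, adjoining it changes nothing, and [l] bounds the length. *)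
have [uext|nu] := pselect (ext_forms i u).
  left; exists N, P, i, p; split=> //; move: cl.
  rewrite (_ : (fun v => _) = ext_forms i) //; apply/funext => v; apply/propext.
  split=> [[c vc]|/adjoin_sub //].
  rewrite -[v](subrK (c *: u)); apply: submoduleD => //; exact: submoduleZ.
right; have [_ ep sp] := s; have [ik eq sq] := sG.
have [|psi psiP] := extend_to_proj (i := i) (u := k \o dual_form u) fG.
  move=> c; have xm : c (k 1) \in m by apply/km; exists c.
  have [v vP] := um _ xm; exists v => x; rewrite vP.
  rewrite -[RHS]/((c \o k) (dual_form u x))
    (linear_regularE (c \o k) (dual_form u x)).
  exact: (mulrC (c (k 1) : R) (dual_form u x)).
have [|phi phiP] := linear_factor (f := q \o psi) sp.
  by move=> x /ep[y <-] /=; rewrite psiP (ses0 _ sG).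
have [M' [b [c pb]]] := pullback_exists phi q.
have [h [sh ch]] := pullback_ses (pullback_sym pb) sG.
have [|p' p'P] := pullback_univ (u := p \o fst) (v := copair psi k) pb.
  by move=> [x y]; rewrite copairE linearD /= phiP (ses0 _ sG) addr0.
pose i' := pairl i ( \- dual_form u).
have [ih eh sb] := sh; have [cm li z] := pb.
have s' : ses i' p'.
  have [ii _ _] := s; split=> [x y [/ii]//|[x y]|e].
  - have [p'1 p'2] := p'P (x, y); split=> [p'0|[w /= [wx wy]]].
      move: p'1 p'2; rewrite p'0 !linear0 /= => /esym/ep[w <-].
      rewrite psiP /= -linearD => /esym e0; exists w.
      congr (_, _); apply/eqP; rewrite eq_sym -addr_eq0 addrC.
      apply/eqP; apply: ik.
      by rewrite e0 linear0.
    apply: z; rewrite ?p'1 ?p'2 /= -wx -?wy ?(ses0 _ s) //.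
    by rewrite psiP /= linearN subrr.
  - have [x px] := sp (b e).
    have /eq[r rP] : q (c e - psi x) = 0.
      by rewrite linearB -cm -px phiP subrr.
    exists (x, r); have [p1 p2] := p'P (x, r).
    apply/eqP; rewrite -subr_eq0; apply/eqP; apply: z; rewrite linearB ?p1 ?p2.
      by rewrite /= px subrr.
    by rewrite copairE /= rP addrCA subrr addr0 subrr.
exists R^o, G, k, q, M', b, c, phi, h; split=> //; split=> //.
  (* A form on [M'] taking a unit value at [h 1] would, after scaling, yield an extension of [u] to
     [P]. *)
  move=> w; suff /km[v vP] : w (h 1) \in m.
    exists v => x; rewrite -[LHS]/((v \o k) x) -[RHS]/((w \o h) x).
    by rewrite (linear_regularE (v \o k) x) (linear_regularE (w \o h) x) /= vP.
  apply: contrapT => /negP/unit_notin[d wd]; apply: nu.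
  exists ((d \*: w) \o p' \o pairl idfun \0) => x /=.
  have -> : p' (i x, 0) = h (dual_form u x).
    have [p1 p2] := p'P (i x, 0); apply/eqP; rewrite -subr_eq0; apply/eqP.
    apply: z; rewrite linearB ?p1 ?p2.
      by rewrite /= (ses0 _ s) (ses0 _ sh) subrr.
    by rewrite ch copairE /= psiP linear0 addr0 subrr.
  rewrite -[w _]/((w \o h) (dual_form u x))
    (linear_regularE (w \o h) (dual_form u x)) /=.
  by rewrite [LHS]mulrCA [d * _]mulrC wd mulr1.
exists N, (P * R^o)%type, i', p'; split=> //.
  by apply: fg_proj_prod fP _; apply: fg_proj_regular.
(* A form on [P * R] is a form on [P] and a scalar, so the forms extending along [i'] are those
   extending along [i] up to a multiple of [u]. *)
rewrite (_ : ext_forms i' = (fun v => exists c, ext_forms i (v - c *: u))) //.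
apply/funext => g; apply/propext; split=> [[v vP]|[d [v vP]]].
  exists (- (v (0, 1) : R)), (v \o pairl idfun \0) => x.
  rewrite -[RHS]/(dual_form g x - (- (v (0, 1) : R)) * dual_form u x).
  rewrite -vP mulNr opprK.
  rewrite -[(v (0, 1) : R) * _]mulrC -[_ * (v (0,1) : R)]/(_ *: v (0, 1)).
  rewrite -linearZ_LR -linearD; congr (v _); congr (_, _) => /=.
    by rewrite scaler0 addr0.
  by rewrite [_ *: _]mulr1 addNr.
exists (copair v ( \- (d \*: idfun))) => x; rewrite copairE /= vP.
rewrite -[X in X + _]/(dual_form g x - d * dual_form u x) scalerN opprK.
by rewrite subrK.
Qed.

(** The case of [N] and [T'] supplies [phi : N -> T']. Forms on [N] extend over [P], so [k' \o phi]
    extends too and induces [phi' : M -> T]. The pullback of [phi'] is [P * G] modulo [N']. *)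
Lemma socle_killS j l M T :
  (forall M T, cosyz m j T -> ext_length j l.+1 M ->
     ext_length j l M \/ socle_kill j l M T) ->
  cosyz m j.+1 T -> ext_length j.+1 l.+1 M ->
  ext_length j.+1 l M \/ socle_kill j.+1 l M T.
Proof.
move=> IHj [T' [G' [k' [q' [fG' s' ek' cT']]]]] [N [P [i [p [fP s ei eN]]]]].
have [eN'|] := IHj N T' cT' eN; first by left; exists N, P, i, p.
move=> [K [G [k [q [N' [b [c [phi [h [fG sk pb [sh ch eh lN']]]]]]]]]]].
right; have [ii ep sp] := s; have [_ eq sq] := sk; have [ik' eq' sq'] := s'.
have [psi psiP] := forms_extend_proj (k' \o phi) ei fG'.
have [|phi' phi'P] := linear_factor (f := q' \o psi) sp.
  by move=> x /ep[y <-] /=; rewrite psiP (ses0 _ s').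
have [M' [b' [c' pb']]] := pullback_exists phi' q'.
have [h' [sh' ch']] := pullback_ses (pullback_sym pb') s'.
have [|p' p'P] := pullback_univ (u := p \o fst)
  (v := copair psi ( \- (k' \o q))) pb'.
  by move=> [x y]; rewrite copairE linearB /= phi'P (ses0 _ s') subr0.
exists T', G', k', q', M', b', c', phi', h'; split=> //; split=> //.
  by move=> u; apply: (ek' (u \o h')).
have [cm li z] := pb; have [cm' li' z'] := pb'.
exists N', (P * G)%type, (pairl (i \o b) c), p'; split=> //.
- exact: fg_proj_prod.
- split=> [|[x y]|e].
  + apply: linear_inj => x; rewrite pairlE => -[/= ib0 c0]; apply: z => //.
    by apply: ii; rewrite ib0 linear0.
  + have [p'1 p'2] := p'P (x, y); split=> [p'0|[w /= [<- <-]]].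
      move: p'1 p'2; rewrite p'0 !linear0 /= => /esym/ep[w <-].
      rewrite psiP /= => /esym/eqP; rewrite subr_eq0 => /eqP/ik'.
      by move=> /li[e [<- <-]]; exists e.
    have [p'3 p'4] := p'P (i (b w), c w).
    apply: z'; rewrite ?p'3 ?p'4 /= ?(ses0 _ s) //.
    by rewrite psiP /= cm subrr.
  + have [x px] := sp (b' e).
    have /eq'[r rP] : q' (c' e - psi x) = 0.
      by rewrite linearB -cm' -px phi'P subrr.
    have [y yP] := sq (- r).
    exists (x, y); have [p1 p2] := p'P (x, y).
    apply/eqP; rewrite -subr_eq0; apply/eqP; apply: z'; rewrite linearB ?p1 ?p2.
      by rewrite /= px subrr.
    by rewrite copairE /= yP linearN opprK rP addrCA subrr addr0 subrr.
(* Subtracting [v \o c], where [v] extends [u \o h], leaves a form that descends to [N], where forms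
   extend over [P]. *)
- move=> u; have [v vP] := eh u; have [ih eh' sb] := sh.
  have [|w wP] := linear_factor (f := u \- (v \o c)) sb.
    by move=> x /eh'[y <-] /=; rewrite ch vP subrr.
  have [w' w'P] := ei w.
  by exists (copair w' v) => x; rewrite copairE /= w'P wP /= subrK.
Qed.

Lemma socle_killP j l M T : cosyz m j T -> ext_length j l.+1 M ->
  ext_length j l M \/ socle_kill j l M T.
Proof.
elim: j M T => [|j IHj] M T; first exact: socle_kill0.
exact: socle_killS.
Qed.

(** Two nested inductions: on the number [n - j] of degrees where [Ext] may survive, and on the
    length of [Ext^(j+1)]. In [0 -> M' -> M * G -> T -> 0] the length bound for [M'] is smaller, and
    [M] is recovered by extension and summand. *)
Theorem fpdt_extension_closed n X : extension_closed X -> X R^o ->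
  (forall j, (j < n)%N -> exists2 T, X T & cosyz m j T) ->
  subcat_sub (fpdt m n) X.
Proof.
move=> ecX XR XT; have [fX sX eX] := ecX.
have [[_ _ eF] _ _] := resolving_fpdt m n.
suff H d j M : (j + d = n)%N -> ext_vanish j M -> fpdt m n M -> X M.
  by move=> M; apply: (H n 0%N).
elim: d j M => [|d IHd] j M.
  rewrite addn0 => -> vM [pM _]; apply: ext_closed_proj ecX XR _.
  exact: ext_vanish_proj vM pM.
move=> jn vM fM; have [l lM] := ext_length_exists vM fM.
have [|T XT1 cT] := XT j; first by rewrite -jn addnS ltnS leq_addr.
have fT : fpdt m n T.
  have [pT tT] := cosyz_fpdt cT; split=> //; apply: pdl_leq pT.
  by rewrite -jn addnS ltnS leq_addr.
elim: l M {vM} fM lM => [|l IHl] M fM lM.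
  by apply: (IHd j.+1) => //; [rewrite addSnnS|exact: ext_length0].
have [lM'|] := socle_killP cT lM; first exact: IHl.
move=> [K [G [k [q [M' [b [c [phi [h [fG sk pb [_ _ _ lM']]]]]]]]]]].
have sq : surjective q by case: sk.
have s := pullback_short pb sq.
have fMG : fpdt m n (M * G)%type.
  apply: eF (ses_short (ses_prod _ _)) fM _.
  exact: resolving_proj (resolving_fpdt m n) fG.
have fM' := resolving_ker_epi (resolving_fpdt m n) s fMG fT.
apply: sX (summand_prodl M G); apply: eX (ses_short s) _ XT1.
exact: IHl.
Qed.

End KillExt.

(** * Recovering cosyzygies inside a resolving subcategory *)

Section LocalResolving.
Variables (R : comNzRingType) (m : idealr R).
Hypothesis noethR : noetherian R.
Hypothesis unit_notin : forall x, x \notin m -> exists y, x * y = 1.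
Implicit Types (E F G K L M N P T U V W : lmodType R) (X : subcat R).

Lemma local_unitP (a : R) :
  (exists b, a * b = 1) \/ (exists b, (1 - a) * b = 1).
Proof.
have [am|] := boolP (a \in m); last by left; apply: unit_notin.
right; apply: unit_notin; apply/negP => am'.
by have := rpredD am' am; rewrite subrK idealr1.
Qed.

Lemma minimal_cover M : fin_gen M ->
  exists n N (i : {linear N -> 'rV[R]_n}) (p : {linear 'rV[R]_n -> M}),
    ses i p /\ forall x j, i x 0 j \in m.
Proof.
move=> /fin_genP fM.
have ex : exists n, `[< exists e : {linear 'rV[R]_n -> M}, surjective e >].
  by have [n ne] := fM; exists n; apply/asboolP.
case: (ex_minnP ex) => n /asboolP[p sp] nmin.
have [N [i s]] := ses_surj sp; exists n, N, i, p; split=> // x j.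
apply: contrapT => /negP/unit_notin[c xc].
case: n => [|n] in p sp nmin i s j x xc *; first by case: j xc.
suff /nmin : `[< exists e : {linear 'rV[R]_n -> M}, surjective e >].
  by rewrite ltnn.
apply/asboolP; exists (row_lin (fun k => p (delta_mx 0 (lift j k)))) => y.
have [z zy] := sp y; pose w := z - (z 0 j * c) *: i x.
have wj : w 0 j = 0 by rewrite !mxE -mulrA [c * _]mulrC xc mulr1 subrr.
exists (\row_k w 0 (lift j k)).
rewrite row_linE -zy (_ : p z = p w); last first.
  by rewrite linearB linearZ_LR (ses0 _ s) scaler0 subr0.
rewrite [RHS]linear_rowE (bigD1_ord j) //= wj scale0r add0r.
by apply: eq_bigr => k _; rewrite mxE.
Qed.

(** [M] is [T] plus a projective, modulo [K]. Surjectivity is required of [pi] alone because the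
    induction in [presentedP] lifts elements through it. *)
Definition presented n M T :=
  exists F (theta : {linear T -> M}) (pi : {linear F -> M}) K
    (i : {linear K -> (T * F)%type}),
  [/\ fg_proj F, surjective pi, ses i (copair theta pi) & pdl n K].

Lemma surjective_copair T F M (theta : {linear T -> M}) (pi : {linear F -> M}) :
  surjective pi -> surjective (copair theta pi).
Proof.
by move=> sp y; have [x <-] := sp y; exists (0, x);
  rewrite copairE /= linear0 add0r.
Qed.

Lemma fg_proj_unimodular N : fg_proj N ->
  (forall x : N, x = 0) \/ exists f (rho : {linear N -> R^o}), rho f = 1.
Proof.
move=> /(fg_proj_free local_unitP)[r [f [g fK gK]]].
case: r => [|r] in f g fK gK *; [left|right].
  by move=> x; rewrite -(fK x) (thinmx0 (f x)) -(thinmx0 (f 0)) fK.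
have lr : linear (fun y => f y 0 0 : R^o) by move=> c x y; rewrite linearP !mxE.
by exists (g (delta_mx 0 0)), (mklin lr); rewrite /= gK mxE !eqxx.
Qed.

(** The syzygy [N] is free and nonzero; let [f] be a basis vector. By minimality [i f] has
    coordinates in [m], so the map sending 1 to [i f] extends from [R] to [G] and induces [theta].
    The kernel [K] is the cokernel of [R -> G * N], which splits because some form is 1 on [f]. *)
Lemma presented0 M T : cosyz m 0 T -> pdl 1 M -> ~ fg_proj M -> presented 0 M T.
Proof.
move=> [G [k [q [fG sk km]]]] pM nM.
have [n [N [i [p [s im]]]]] := minimal_cover (pdl_fin_gen pM).
have [ii ep sp] := s; have [ik eq sq] := sk.
have fN : fg_proj N := pdl_syzygy s (fg_proj_row R n) pM.
have [N0|[f [rho rf]]] := fg_proj_unimodular fN.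
  case: nM; apply: fg_proj_iso (fg_proj_row R n).
  apply: (isomorphic_bij (f := p)) => //; apply: linear_inj => x /ep[y <-].
  by rewrite (N0 y) linear0.
have lu : linear (fun c : R^o => (c : R) *: i f).
  by move=> c x y; rewrite scalerDl scalerA.
have [|psi psiP] := extend_to_proj (i := k) (u := mklin lu) (fg_proj_row R n).
  move=> c; have /km[v vc] : (c (i f) : R) \in m.
    rewrite linear_rowE; apply: rpred_sum => j _.
    rewrite -[_ *: _]/(i f 0 j * (c (delta_mx 0 j) : R)) mulrC.
    exact: idealMr.
  exists v => x; rewrite -[LHS]/((v \o k) x) (linear_regularE (v \o k) x) /= vc.
  by rewrite [RHS]linearZ_LR.
have [|theta thetaP] := linear_factor (f := p \o psi) sq.
  move=> x /eq[y <-] /=.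
  by rewrite psiP /= linearZ_LR (ses0 _ s) scaler0.
have [K [j sj]] := ses_surj (surjective_copair theta sp); have [ij ej _] := sj.
exists 'rV[R]_n, theta, p, K, j; split=> //; first exact: fg_proj_row.
have [|h hP] := linear_lift
  (f := pairl (q \o fst) ((i \o snd) \- (psi \o fst)) :
    {linear (G * N)%type -> _}) ij.
  move=> [x y]; apply/ej; rewrite copairE /= thetaP /= linearB /=.
  by rewrite (ses0 _ s) sub0r subrr.
have lf : linear (fun c : R^o => (c : R) *: f).
  by move=> c x y; rewrite scalerDl scalerA.
have sh : ses (pairl k (mklin lf)) h.
  split=> [x y [/ik] //|[x y]|e].
  - split=> [hx|[c [<- <-]]].
      have := hP (x, y); rewrite hx linear0 => -[/esym/eq[c <-]].
      rewrite psiP /= => /esym/eqP; rewrite subr_eq0 -linearZ_LR => /eqP/ii ->.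
      by exists c.
    apply: ij; rewrite hP pairlE /= (ses0 _ sk) linear0 psiP /=.
    by rewrite linearZ_LR subrr.
  - have /ej : exists e', j e' = j e by exists e.
    case je: (j e) => [t z]; rewrite copairE /=.
    have [x xt] := sq t; rewrite -xt thetaP /= -linearD => /ep[y yP].
    by exists (x, y); apply: ij;
      rewrite hP je pairlE /= yP addrAC subrr add0r xt.
have iso := ses_retract_iso (r := rho \o snd) sh.
apply: (fg_proj_summand (V := (R^o * K)%type)); first exact: summand_prodr.
apply: fg_proj_iso (isomorphic_sym (iso _)) (fg_proj_prod fG fN).
by move=> c /=; rewrite linearZ_LR rf [LHS]mulr1.
Qed.

(** The map [theta : T' -> N] from the induction extends to [G -> P], since forms on [T'] extend,
    and so induces [T -> M]. The new kernel is covered by [G * F] with the old [K] as kernel, so its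
    dimension grows by at most one. *)
Lemma presentedP n M T : cosyz m n T -> pdl n.+1 M -> ~ pdl n M ->
  presented n M T.
Proof.
elim: n M T => [|n IHn] M T; first exact: presented0.
move=> [T' [G [k [q [fG sk ek cT]]]]] pM nM.
have [a [N [i [p s]]]] := cover_exists (pdl_fin_gen pM).
have fP := fg_proj_row R a; have [ii ep sp] := s; have [ik eq sq] := sk.
have pN : pdl n.+1 N := pdl_syzygy s fP pM.
have nN : ~ pdl n N by move=> pN'; apply: nM; exists N, 'rV[R]_a, i, p.
have [F [theta [pi [K [j [fF spi sj pK]]]]]] := IHn N T' cT pN nN.
have [ij ej _] := sj.
have [psi psiP] := forms_extend_proj (i \o theta) ek fP.
have [|theta' theta'P] := linear_factor (f := p \o psi) sq.
  by move=> x /eq[y <-] /=; rewrite psiP (ses0 _ s).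
have [K' [j' sj']] := ses_surj (surjective_copair theta' sp);
  have [ij' ej' _] := sj'.
exists 'rV[R]_a, theta', p, K', j'; split=> //.
have [|h hP] := linear_lift (f := pairl (q \o fst)
   (( \- (i \o pi \o snd)) \- (psi \o fst)) : {linear (G * F)%type -> _}) ij'.
  move=> [x y]; apply/ej'; rewrite copairE /= theta'P /= linearB linearN /=.
  by rewrite (ses0 _ s) oppr0 sub0r subrr.
exists K, (G * F)%type, (pairl (k \o fst \o j) (snd \o j)), h; split=> //.
  exact: fg_proj_prod.
split=> [|[x y]|e].
- apply: linear_inj => x; rewrite pairlE => -[/= kx jx]; apply: ij.
  rewrite linear0; have : (j x).1 = 0 by apply: ik; rewrite kx linear0.
  by case: (j x) jx => ? ? /= -> ->.
- split=> [hx|[c [<- <-]]].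
    have := hP (x, y); rewrite hx linear0 => -[/esym/eq[t <-]].
    rewrite psiP /= -opprD => /esym/eqP; rewrite oppr_eq0 -linearD => /eqP ipt.
    have /ej[c cE] : copair theta pi (t, y) = 0.
      by rewrite copairE /= addrC; apply: ii; rewrite ipt linear0.
    by exists c; rewrite /= cE.
  have /ej : exists e, j e = j c by exists c.
  rewrite copairE => jc0; apply: ij';
    rewrite hP pairlE /= (ses0 _ sk) linear0 psiP /=.
  by rewrite -opprD -linearD addrC jc0 linear0 oppr0.
- have /ej' : exists e', j' e' = j' e by exists e.
  case je: (j' e) => [t z]; rewrite copairE /=.
  have [x xt] := sq t; rewrite -xt theta'P /= -linearD => /ep[y yP].
  have [w wP] := spi (- y).
  exists (x, w); apply: ij'; rewrite hP je pairlE /= wP linearN opprK yP.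
  by rewrite addrAC subrr add0r xt.
Qed.

(** By induction, applied to a syzygy of [M], the modules of smaller projective dimension are in
    [X]. The kernel [K] of [presentedP] is among them, so the extension [T * F] of [M] by [K] and
    its summand [T] are in [X], and [fpdt_extension_closed] applies. *)
Theorem fpdt_sub_resolving n M X : resolving X ->
  (forall j, (j <= n)%N -> exists T, cosyz m j T) ->
  fpdt m n.+1 M -> ~ pdl n M -> X M -> subcat_sub (fpdt m n.+1) X.
Proof.
move=> rX; elim: n M => [|n IHn] M cT fM nM XM.
  have [T cT0] := cT 0%N isT.
  have [F [theta [pi [K [j [fF spi sj pK]]]]]] := presentedP cT0 fM.1 nM.
  have [ecX _ _] := rX; have [_ sX eX] := ecX.
  have XTF := eX _ _ _ (ses_short sj) (resolving_proj rX pK) XM.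
  apply: (fpdt_extension_closed noethR unit_notin ecX).
    exact: resolving_proj rX (fg_proj_regular R).
  by case=> // _; exists T => //; apply: sX XTF _; apply: summand_prodl.
have [a [N [i [p s]]]] := cover_exists (pdl_fin_gen fM.1).
have fP := fg_proj_row R a; have [rX1 rX2 rX3] := rX.
have XN : X N by apply: rX3 (ses_short s) fP.1 fP.2 XM.
have [_ _ rF3] := resolving_fpdt m n.+2.
have fN : fpdt m n.+1 N.
  split; first exact: (pdl_syzygy s fP fM.1).
  by have [_ tN] := rF3 _ _ _ (ses_short s) fP.1 fP.2 fM.
have nN : ~ pdl n N by move=> pN'; apply: nM; exists N, 'rV[R]_a, i, p.
have subX : subcat_sub (fpdt m n.+1) X.
  by apply: IHn fN nN XN => j jn; apply: cT; apply: leqW.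
have [T cTn] := cT n.+1 (leqnn _).
have [F [theta [pi [K [j [fF spi sj pK]]]]]] := presentedP cTn fM.1 nM.
have fT := cosyz_fpdt cTn.
have [[_ sX eX] _ _] := rX.
have tK : fpdt m n.+2 K.
  apply: resolving_ker_epi (resolving_fpdt m n.+2) sj _ fM.
  have [[_ _ eF] _ _] := resolving_fpdt m n.+2.
  apply: eF (ses_short (ses_prod _ _)) fT _.
  exact: resolving_proj (resolving_fpdt m n.+2) fF.
have XK : X K by apply: subX; split=> //; case: tK.
have XTF := eX _ _ _ (ses_short sj) XK XM.
apply: (fpdt_extension_closed noethR unit_notin rX1).
  exact: resolving_proj rX (fg_proj_regular R).
move=> j0; rewrite ltnS leq_eqVlt => /orP[/eqP ->|jn].
  by exists T => //; apply: sX XTF _; apply: summand_prodl.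
have [T' cT'] := cT j0 (ltnW jn); exists T' => //; apply: subX.
by have [pT' tT'] := cosyz_fpdt cT'; split=> //; apply: pdl_leq pT'.
Qed.

End LocalResolving.

(** * Prime avoidance and socle elements modulo an ideal *)

Section Socle.
Variable R : comNzRingType.
Hypothesis noethR : noetherian R.
Variables (m : idealr R) (I : R^o -> Prop).
Hypothesis sI : submodule I.

(** The annihilator of [z] in [R / I] is maximal among those of nonzero elements, hence an
    associated prime. *)
Definition max_ann (z : R) := ~ I z /\ forall w : R, ~ I w ->
  (forall a : R, I (a * z) -> I (a * w)) -> forall a : R, I (a * w) ->
    I (a * z).

Lemma submodule_ann (z : R) : @submodule R R^o (fun a : R => I (a * z)).
Proof.
split=> [|a x y Ix Iy]; first by rewrite mul0r; case: sI.
rewrite mulrDl; apply: (submoduleD sI) => //; rewrite -mulrA.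
exact: (submoduleZ _ sI).
Qed.

Lemma max_ann_above (v : R) : ~ I v ->
  exists2 z : R, max_ann z & forall a : R, I (a * v) -> I (a * z).
Proof.
move=> nv; pose T := {z : R | ~ I z /\ forall a : R, I (a * v) -> I (a * z)}.
have t0 : T by exists v.
have [|[z [nz vz]] zmax] := @noeth_mod_max R R^o T
    (fun t a => I ((a : R) * sval t)) (noeth_regular noethR) _ t0.
  by move=> t; apply: submodule_ann.
exists z => //; split=> // w nw zw a.
by apply: (zmax (exist _ w (conj nw (fun a h => zw a (vz a h))))).
Qed.

Lemma max_ann_prime (z a b : R) : max_ann z -> I (a * b * z) ->
  I (a * z) \/ I (b * z).
Proof.
move=> [nz zmax] abz; have [|nbz] := pselect (I (b * z)); [by right|left].
apply: (zmax (b * z) nbz) => [c cz|]; last by rewrite mulrA.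
by rewrite mulrCA; apply: (submoduleZ _ sI).
Qed.

(** The product of the individual multipliers works because the annihilator of [z] modulo [I] is
    prime. *)
Lemma max_ann_avoid (z : R) (s : seq R) : max_ann z ->
  (forall z', z' \in s -> exists2 w : R, I (w * z') & ~ I (w * z)) ->
  exists2 w : R, ~ I (w * z) & forall z', z' \in s -> I (w * z').
Proof.
move=> mz; elim: s => [|y s IHs] sP.
  by exists 1 => //; rewrite mul1r; case: mz.
have [|w nw wP] := IHs; first by move=> z' zs; apply: sP; rewrite inE zs orbT.
have [|w' w'y nw'] := sP y; first by rewrite inE eqxx.
exists (w * w'); first by move=> /(max_ann_prime mz)[].
move=> z'; rewrite inE => /orP[/eqP ->|/wP Iw].
  by rewrite -mulrA; apply: (submoduleZ _ sI).
by rewrite mulrAC -[_ * w']mulrC; apply: (submoduleZ _ sI).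
Qed.

Definition adjoin_seq (s : seq R) : R^o -> Prop :=
  foldr (fun z U v => exists c : R, U (v - c *: (z : R^o))) I s.

Lemma submodule_adjoin_seq s : submodule (adjoin_seq s).
Proof. by elim: s => //= z s IHs; apply: submodule_adjoin. Qed.

Lemma adjoin_seq_ann s (w v : R) : (forall z, z \in s -> I (w * z)) ->
  adjoin_seq s v -> I (w * v).
Proof.
elim: s v => [|z s IHs] v ws /=; first by move=> Iv; apply: (submoduleZ _ sI).
move=> [c vc]; rewrite -[v](subrK (c * z)) mulrDr; apply: (submoduleD sI).
  by apply: IHs => // y ys; apply: ws; rewrite inE ys orbT.
by rewrite mulrCA; apply: (submoduleZ _ sI) => //; apply: ws; rewrite inE eqxx.
Qed.

(* The maximal annihilators are prime and finitely many of them suffice, so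
   prime avoidance applies to the zero divisors modulo [I]. *)
Lemma socle_exists : (forall y, y \in m -> exists2 a : R, I (a * y) & ~ I a) ->
  exists2 z : R, ~ I z & forall x, x \in m -> I (x * z).
Proof.
move=> zdiv; apply: contrapT => nosocle.
have nsoc z : ~ I z -> exists2 x, x \in m & ~ I (x * z).
  move=> nz; apply: contrapT => nx; apply: nosocle; exists z => // x xm.
  by apply: contrapT => nxz; apply: nx; exists x.
(* If the annihilator of [z] is not inside the maximal annihilator of [z'], the reverse inclusion
   fails as well. *)
have sep z z' : max_ann z' -> ~ I z -> (exists2 y, I (y * z) & ~ I (y * z')) ->
    exists2 w : R, I (w * z') & ~ I (w * z).
  move=> mz' nz [y yz nyz']; apply: contrapT => nw; apply: nyz'.
  apply: (mz'.2 z nz _ y yz) => a az'; apply: contrapT => naz.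
  by apply: nw; exists a.
(* If [y] avoids the earlier annihilators but kills [z], it is corrected by [x * w], where [w] kills
   the earlier elements but not [z], and [x] in [m] does not kill [z]. *)
have avoid (s : seq R) : (forall z, z \in s -> max_ann z) ->
    exists2 y, y \in m & forall z, z \in s -> ~ I (y * z).
  elim: s => [|z s IHs] ms; first by exists 0; rewrite ?rpred0.
  have [|y ym yP] := IHs; first by move=> z' zs; apply: ms; rewrite inE zs orbT.
  have mz : max_ann z by apply: ms; rewrite inE eqxx.
  have [yz|nyz] := pselect (I (y * z)); last first.
    by exists y => // z'; rewrite inE => /orP[/eqP ->|/yP].
  have [|w nw wP] := @max_ann_avoid z s mz.
    move=> z' zs; apply: sep; [|by case: mz|by exists y => //; apply: yP].
    by apply: ms; rewrite inE zs orbT.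
  have [x xm nx] := nsoc z mz.1.
  have nxw : ~ I (x * w * z) by move=> /(max_ann_prime mz)[].
  exists (y + x * w); first by rewrite rpredD // mulrC idealMr.
  move=> z'; rewrite inE mulrDl => /orP[/eqP -> h|zs h].
    apply: nxw; have := submoduleB sI h yz.
    by rewrite addrAC subrr add0r.
  apply: (yP z' zs); have : I (x * w * z').
    by rewrite -mulrA; apply: (submoduleZ _ sI) => //; apply: wP.
  by move=> /(submoduleB sI h); rewrite addrK.
pose T := {s : seq R | forall z, z \in s -> max_ann z}.
have t0 : T by exists [::].
(* A maximal [I + (s)] contains every element of maximal annihilator. *)
have [s ms smax] : exists2 s : seq R, forall z, z \in s -> max_ann z
    & forall z, max_ann z -> adjoin_seq s z.
  have [|[s ms] smax] := @noeth_mod_max R R^o T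
    (fun t => adjoin_seq (sval t)) (noeth_regular noethR) _ t0.
    by move=> t; apply: submodule_adjoin_seq.
  exists s => // z mz.
  have ms' z' : z' \in z :: s -> max_ann z' by rewrite inE => /orP[/eqP ->|/ms].
  apply: (smax (exist _ (z :: s) ms')) => [x sx|] /=;
    first exact: adjoin_sub sx.
  exists 1; rewrite scale1r subrr; exact: (submodule_adjoin_seq s).1.
(* The element [y] kills none of [s] but does kill some [z] of maximal annihilator. Hence some [w]
   kills all of [s] but not [z], although [z] lies in [I + (s)]. *)
have [y ym yP] := avoid s ms; have [v vy nv] := zdiv y ym.
have [z mz vz] := max_ann_above nv.
have yz : I (y * z) by apply: vz; rewrite mulrC.
have [|w nw wP] := @max_ann_avoid z s mz.
  move=> z' zs; apply: sep (ms _ zs) mz.1 _.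
  by exists y => //; apply: yP.
by apply: nw; apply: adjoin_seq_ann wP (smax z mz).
Qed.

End Socle.

(** * The Auslander-Buchsbaum bound *)

Section AuslanderBuchsbaum.
Variables (R : comNzRingType) (m : idealr R).
Hypothesis noethR : noetherian R.
Hypothesis unit_notin : forall x, x \notin m -> exists y, x * y = 1.
Implicit Types (E F G K L M N P T U V W : lmodType R).

(** Membership in [(s) V]. Coefficients are indexed by [nat] so that they need no transport when the
    sequence grows. *)
Definition span_mod (s : seq R) V (x : V) :=
  exists c : nat -> V, x = \sum_(i < size s) s`_i *: c i.

Lemma span_mod_nil V (x : V) : span_mod [::] x <-> x = 0.
Proof.
split=> [[c ->]|->]; first by rewrite big_ord0.
by exists (fun=> 0); rewrite big_ord0.
Qed.

Lemma span_mod_rcons s a V (x : V) :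
  span_mod (rcons s a) x <-> exists y, span_mod s (x - a *: y).
Proof.
have e (c : nat -> V) : \sum_(i < size (rcons s a)) (rcons s a)`_i *: c i =
    \sum_(i < size s) s`_i *: c i + a *: c (size s).
  rewrite size_rcons big_ord_recr /= nth_rcons ltnn eqxx; congr (_ + _).
  by apply: eq_bigr => i _; rewrite nth_rcons ltn_ord.
split=> [[c ->]|[y [c cP]]].
  by exists (c (size s)), c; rewrite e addrK.
pose c' i := if i == size s then y else c i.
exists c'; rewrite e /c' eqxx -[LHS](subrK (a *: y)) cP; congr (_ + _).
by apply: eq_bigr => i _; rewrite ltn_eqF.
Qed.

Lemma submodule_span_mod s V : submodule (@span_mod s V).
Proof.
split=> [|a x y [c ->] [d ->]].
  by exists (fun=> 0); rewrite big1 // => i _; rewrite scaler0.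
exists (fun i => a *: c i + d i); rewrite scaler_sumr -big_split.
by apply: eq_bigr => i _; rewrite /= scalerDr !scalerA mulrC.
Qed.

Lemma span_mod_map s U V (f : {linear U -> V}) x :
  span_mod s x -> span_mod s (f x).
Proof.
move=> [c ->]; exists (f \o c); rewrite linear_sum.
by apply: eq_bigr => i _; rewrite linearZ_LR.
Qed.

Lemma span_mod_lift s U V (f : {linear U -> V}) y :
  surjective f -> span_mod s y -> exists2 x, span_mod s x & f x = y.
Proof.
move=> sf [c ->]; pose d i := sval (cid (sf (c i))).
exists (\sum_(i < size s) s`_i *: d i); first by exists d.
rewrite linear_sum; apply: eq_bigr => i _.
by rewrite linearZ_LR /d; case: cid => /= x ->.
Qed.

Lemma in_spanP s (x : R) : in_span s x <-> span_mod s (x : R^o).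
Proof.
split=> [[c ->]|[c ->]].
  exists (fun i => if insub i is Some j then c j else 0).
  by apply: eq_bigr => i _; rewrite insubT //= => p; rewrite mulrC;
    congr (_ * c _); apply: val_inj.
by exists (fun i => c i); apply: eq_bigr => i _; rewrite [LHS]mulrC.
Qed.

Lemma span_mod_row s n (v : 'rV[R]_n) :
  span_mod s v <-> forall j, in_span s (v 0 j).
Proof.
split=> [sv j|sv].
  have lj : linear (fun v : 'rV[R]_n => v 0 j : R^o) by move=> a x y;
    rewrite !mxE.
  by apply/in_spanP; apply: (span_mod_map (mklin lj)).
have c j : exists c : nat -> R, v 0 j = \sum_(i < size s) s`_i * c i.
  by apply/in_spanP.
pose d j := sval (cid (c j)); exists (fun i => \row_j d j i).
apply/rowP => j; rewrite summxE.
rewrite (svalP (cid (c j))); apply: eq_bigr => i _; by rewrite !mxE.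
Qed.

Lemma regular_proj s i P (x : P) : regular_seq s -> (i < size s)%N ->
  fg_proj P ->
  span_mod (take i s) (s`_i *: x) -> span_mod (take i s) x.
Proof.
move=> [reg _] si /fg_projP[n [f [g gf]]] sx.
rewrite -(gf x); apply: span_mod_map; apply/span_mod_row => j.
apply: (reg i si); move/(span_mod_map f)/span_mod_row/(_ j) : sx.
by rewrite linearZ_LR mxE mulrC.
Qed.

Fixpoint is_syzygy (l : nat) M : Prop :=
  if l is l'.+1 then
    exists N P (i : {linear M -> P}) (p : {linear P -> N}),
      [/\ fg_proj P, ses i p & is_syzygy l' N]
  else True.

Lemma is_syzygyS l M : is_syzygy l.+1 M -> is_syzygy l M.
Proof.
by elim: l M => [|l IHl] M // [N [P [i [p [fP s /IHl z]]]]]; exists N, P, i, p.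
Qed.

(* [Tor_1(M, R/(s_0, ..., s_(l-1))) = 0] for an [l]-th syzygy [M]. *)
Lemma syzygy_tor s l N F M (i : {linear N -> F}) (p : {linear F -> M}) x :
  regular_seq s -> (l <= size s)%N -> is_syzygy l M -> ses i p ->
  span_mod (take l s) (i x) -> span_mod (take l s) x.
Proof.
move=> reg; elim: l N F M i p x => [|l IHl] N F M i p x ls zM sip.
  rewrite take0 => /span_mod_nil ix; apply/span_mod_nil.
  by case: sip => ii _ _; apply: ii; rewrite ix linear0.
have [M' [P [j [r [fP sjr zM']]]]] := zM; have [ii ep sp] := sip.
have S := submodule_span_mod; rewrite (take_nth 0) // => /span_mod_rcons[f sf].
(* [M] embeds in [P], where [s_l] is regular modulo the earlier elements; the induction for [M']
   brings the conclusion back to [M]. *)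
have spf : span_mod (take l s) (p f).
  apply: (IHl _ _ _ _ _ _ (ltnW ls) zM' sjr).
  apply: (regular_proj reg ls fP).
  rewrite -!linearZ_LR; apply: span_mod_map.
  have /(span_mod_map p) := sf; rewrite linearB (ses0 _ sip) sub0r.
  by move=> /(submoduleZ (-1) (S _ _)); rewrite scaleN1r opprK.
have [f' sf' pf'] := span_mod_lift sp spf.
have /ep[n nE] : p (f - f') = 0 by rewrite linearB pf' subrr.
apply/span_mod_rcons; exists n.
apply: (IHl _ _ _ _ _ _ (ltnW ls) (is_syzygyS zM) sip).
rewrite linearB linearZ_LR nE scalerBr opprB addrC -addrA [- _ + _]addrC.
apply: submoduleD (S _ _) _ sf; exact: submoduleZ.
Qed.

Variable t : nat.
Hypothesis depthR : depth_is m t.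

Lemma in_span_ideal s x : {subset s <= m} -> in_span s x -> x \in m.
Proof.
move=> sm [c ->]; apply: rpred_sum => i _; rewrite mulrC [_ * _]mulrC.
by apply: idealMr; apply: sm; apply: mem_nth.
Qed.

(** An element of [m] regular modulo [s] would extend the sequence beyond the depth, so [m] consists
    of zero divisors modulo [s], and [socle_exists] applies. *)
Lemma depth_socle s : regular_seq s -> {subset s <= m} -> size s = t ->
  exists2 z, ~ in_span s z & forall x, x \in m -> in_span s (x * z).
Proof.
move=> reg sm st.
have sI : @submodule R R^o (in_span s).
  have [S0 SD] := submodule_span_mod s R^o; split=> [|a x y].
    exact/in_spanP.
  by move=> /in_spanP sx /in_spanP sy; apply/in_spanP; apply: SD.
apply: (socle_exists noethR sI) => y ym; apply: contrapT => ny.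
suff rreg : regular_seq (rcons s y).
  have := depthR.2 _ rreg; rewrite size_rcons st ltnn => h.
  have // : false by apply: h => x; rewrite mem_rcons inE => /orP[/eqP ->|/sm].
split=> [i|/in_span_ideal h]; last first.
  suff : 1 \in m by rewrite idealr1.
  by apply: h => x; rewrite mem_rcons inE => /orP[/eqP ->|/sm].
rewrite size_rcons ltnS leq_eqVlt => /orP[/eqP -> a|si a].
  rewrite nth_rcons ltnn eqxx -cats1 take_size_cat // => ay.
  by apply: contrapT => na; apply: ny; exists a.
by rewrite nth_rcons si -cats1 takel_cat ?(ltnW si) //; apply: (reg.1 i si).
Qed.

(** A syzygy step trades one unit of [n] for one of [l]. At [n = 0], let [f] be a basis vector of
    the minimal syzygy [N] and [z] a socle element modulo [s]: the image of [z *: f] has coordinates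
    in [(s)], so [z *: f] is in [(s) N] by [syzygy_tor], which would put [z] in [(s)]. *)
Lemma pdl_reduce n l M : (t <= n + l)%N -> is_syzygy l M -> pdl n.+1 M ->
  pdl n M.
Proof.
elim: n l M => [|n IHn] l M tnl zM pM; last first.
  have [a [N [i [p s]]]] := cover_exists (pdl_fin_gen pM).
  have fP := fg_proj_row R a; exists N, 'rV[R]_a, i, p; split=> //.
  apply: (IHn l.+1); first by rewrite addnS -addSn.
    by exists M, 'rV[R]_a, i, p.
  exact: pdl_syzygy s fP pM.
have [[s [reg sm st]] _] := depthR.
have [z nz zP] := depth_socle reg sm st.
have zMt : is_syzygy t M.
  move: tnl zM; rewrite add0n => /subnKC <-; elim: (l - t)%N => [|k IHk].
    by rewrite addn0.
  by rewrite addnS => /is_syzygyS.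
have [a [N [i [p [sip im]]]]] := minimal_cover unit_notin (pdl_fin_gen pM).
have fP := fg_proj_row R a.
have fN : fg_proj N := pdl_syzygy sip fP pM.
have [N0|[f [rho rf]]] := fg_proj_unimodular unit_notin fN.
  apply: fg_proj_iso fP; have [ii ep sp] := sip.
  apply: (isomorphic_bij (f := p)) => //; apply: linear_inj => x /ep[y <-].
  by rewrite (N0 y) linear0.
case: nz; apply/in_spanP.
have : span_mod s (z *: f).
  have := @syzygy_tor s t N _ M i p (z *: f) reg;
    rewrite st take_oversize ?st //.
  apply=> //; apply/span_mod_row => j; rewrite linearZ_LR mxE mulrC.
  exact: zP.
by move=> /(span_mod_map rho); rewrite linearZ_LR rf [_ *: _]mulr1.
Qed.

Lemma pdl_bound n M : pdl n M -> pdl t M.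
Proof.
elim: n => [|n IHn] pM; first exact: pdl_leq pM.
have [nt|tn] := leqP n.+1 t; first exact: pdl_leq nt pM.
by apply: IHn; apply: (@pdl_reduce n 0) pM; rewrite ?addn0.
Qed.

End AuslanderBuchsbaum.

(** * Units of a local ring and existence of primes *)

Section LocalRing.
Variable R : comNzRingType.
Hypothesis noethR : noetherian R.

Lemma idealr_exists (J : R -> Prop) : @submodule R R^o J -> ~ J 1 ->
  exists I : idealr R, forall x, x \in I <-> J x.
Proof.
move=> [J0 JD] J1; pose S : {pred R} := fun x => `[< J x >].
have Sc : idealr_closed S.
  split; [exact/asboolP|exact/asboolP|].
  by move=> a u v /asboolP Ju /asboolP Jv; apply/asboolP; apply: JD.
pose I : idealr R := HB.pack (S : R -> bool) (isIdealr.Build R S Sc).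
by exists I => x; split=> /asboolP.
Qed.

(** If [x] were not a unit, an ideal maximal among the proper ones containing it would be a maximal
    ideal different from [m]. *)
Lemma local_unit (m : idealr R) x : local_ring m -> x \notin m ->
  exists y, x * y = 1.
Proof.
move=> [_ locm] xm; apply: contrapT => nx.
pose T := {J : R^o -> Prop | [/\ submodule J, J x & ~ J 1]}.
have t0 : T.
  exists (fun a : R => exists y, a = x * y); split=> //.
  - split=> [|a _ _ [y ->] [z ->]]; first by exists 0; rewrite mulr0.
    by exists (a * y + z); rewrite mulrDr mulrCA.
  - by exists 1; rewrite mulr1.
  - by move=> [y xy]; apply: nx; exists y.
have [|[J [sJ Jx J1]] Jmax] := @noeth_mod_max R R^o T (@sval _ _)
    (noeth_regular noethR) _ t0; first by case=> ? [].
have [I IJ] := idealr_exists sJ J1.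
suff /locm/(_ x) : maximal_ideal I by rewrite (negPf xm) => /negP; apply;
  apply/IJ.
move=> I' II' y; apply/idP/idP => [yI'|/II' //]; apply/IJ.
have I'P : [/\ @submodule R R^o (fun a : R => a \in I'), x \in I' & ~ 1 \in I'].
  split; last by rewrite idealr1.
    by split=> [|a u v uI vI]; rewrite ?rpred0 // rpredD // idealMr.
  by apply: II'; apply/IJ.
apply: (Jmax (exist _ _ I'P)) yI' => z /= Jz; apply: II'; exact/IJ.
Qed.

(** An ideal maximal among those that contain [J0] and no power of [x] is prime: otherwise powers of
    [x] are multiples of [a] and of [b] modulo it, and their product lies in it. *)
Lemma prime_avoiding (J0 : R^o -> Prop) (x : R) : submodule J0 ->
  (forall k, ~ J0 (x ^+ k)) ->
  exists p : prime_idealr R, (forall a, J0 a -> a \in p) /\ x \notin p.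
Proof.
move=> sJ0 J0x.
pose T := {J : R^o -> Prop | [/\ submodule J, forall a, J0 a -> J a
  & forall k, ~ J (x ^+ k)]}.
have t0 : T by exists J0.
have [J [sJ J0J Jx] Jmax] : exists2 J : R^o -> Prop,
    [/\ submodule J, forall a, J0 a -> J a & forall k, ~ J (x ^+ k)]
    & forall t : T, (forall a, J a -> sval t a) -> forall a, sval t a -> J a.
  have [|[J JP] Jmax] := @noeth_mod_max R R^o T (@sval _ _)
    (noeth_regular noethR) _ t0; first by case=> ? [].
  by exists J.
have adj (a : R) : ~ J a -> exists k (c : R), J (x ^+ k - c * a).
  move=> na; apply: contrapT => nk; apply: na.
  pose J' (v : R^o) := exists c : R, J (v - c *: (a : R^o)).
  have J'P : [/\ submodule J', forall b, J0 b -> J' b & forall k,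
    ~ J' (x ^+ k)].
    split; first exact: submodule_adjoin.
      by move=> b /J0J Jb; apply: adjoin_sub.
    by move=> k [c Jc]; apply: nk; exists k, c.
  apply: (Jmax (exist _ J' J'P)) => [v Jv|] /=; first exact: adjoin_sub.
  by exists 1; rewrite scale1r subrr; case: sJ.
pose S : {pred R} := fun a => `[< J a >].
have Sc : idealr_closed S.
  split; [by apply/asboolP; case: sJ|exact/asboolP/(Jx 0%N)|].
  by move=> a u v /asboolP Ju /asboolP Jv; apply/asboolP; apply: sJ.2.
have Sp : prime_idealr_closed S.
  move=> a b /asboolP Jab; apply/orP; apply: contrapT => nab.
  have [|k [c Ja]] := adj a; first by move=> Ja; apply: nab; left;
    apply/asboolP.
  have [|l [d Jb]] := adj b; first by move=> Jb; apply: nab; right;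
    apply/asboolP.
  apply: (Jx (k + l)%N); rewrite exprD.
  rewrite (_ : _ * _ = x ^+ l * (x ^+ k - c * a) + (c * a) * (x ^+ l - d * b)
    + (c * d) * (a * b)); last by ring.
  by do 2?[apply: (submoduleD sJ)]; apply: (submoduleZ _ sJ).
pose p : prime_idealr R := HB.pack (S : R -> bool) (isIdealr.Build R S Sc)
  (isPrimeIdealrClosed.Build R S Sp).
exists p; split=> [a /J0J Ja|]; first exact/asboolP.
by apply/asboolP; rewrite -[x]expr1; apply: Jx.
Qed.

End LocalRing.

(** * Localization at a prime and freeness *)

Section Localize.
Variables (R : comNzRingType) (p : prime_idealr R).
Implicit Types V W M : lmodType R.

Local Notation A := (loc_ring p).
Local Notation frac := Defs.frac.
Local Notation dv := (@denom_val R p).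

Definition loc_of V (v : V) : localization p V := frac v (denom1 p).
Definition scal_of (a : R) : A := @Defs.frac R p R^o a (denom1 p).

Lemma frac_addl V (v w : V) (s : denom p) :
  frac v s + frac w s = frac (v + w) s.
Proof. by rewrite fracD; apply: frac_eq; rewrite /= -scalerDr scalerA. Qed.

Lemma frac_suml V (I : Type) (r : seq I) (v : I -> V) (s : denom p) :
  \sum_(i <- r) frac (v i) s = frac (\sum_(i <- r) v i) s.
Proof.
elim: r => [|i r IHr]; last by rewrite !big_cons IHr frac_addl.
by rewrite !big_nil; apply: frac_eq; rewrite !scaler0.
Qed.

Lemma scal_frac (a : R) V (v : V) s : scal_of a *: frac v s = frac (a *: v) s.
Proof.
rewrite -[LHS]/(loc_scale _ _) loc_scaleE; apply: frac_eq => /=.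
by rewrite mul1r.
Qed.

Lemma scal_ofM a b : scal_of (a * b) = scal_of a * scal_of b.
Proof. by rewrite -[RHS]/(loc_mul _ _) loc_mulE; apply: frac_eqr => /=;
  ring. Qed.

Lemma scal_of_sum (I : Type) (r : seq I) (c : I -> R) :
  scal_of (\sum_(i <- r) c i) = \sum_(i <- r) scal_of (c i).
Proof. by rewrite -[LHS](@frac_suml R^o). Qed.

Lemma loc_of_eq V (v w : V) : loc_of v = loc_of w <->
  exists2 u, u \notin p & u *: v = u *: w.
Proof.
rewrite fracP; split=> [[u]|[u up uvw]]; rewrite /= ?mulr1.
  by exists (dv u) => //; apply: denomP.
by exists (Denom up); rewrite /= !mulr1.
Qed.

Lemma clear_denom V (z : localization p V) :
  exists2 s, s \notin p & exists v, scal_of s *: z = loc_of v.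
Proof.
have [v [s ->]] := frac_surj z; exists (dv s); first exact: denomP.
by exists v; rewrite scal_frac; apply: frac_eq; rewrite /= scale1r.
Qed.

Lemma common_denom (I : finType) (P : I -> R -> Prop) :
  (forall i a b, P i a -> P i (b * a)) ->
  (forall i, exists2 s, s \notin p & P i s) ->
  exists2 s, s \notin p & forall i, P i s.
Proof.
move=> PM Ps; pose s i := s2val (cid2 (Ps i)).
have sp i : s i \notin p := s2valP (cid2 (Ps i)).
have sP i : P i (s i) := s2valP' (cid2 (Ps i)).
exists (\prod_i s i) => [|i]; last by rewrite (bigD1 i) //= mulrC; apply: PM.
apply: (big_ind (fun x => x \notin p)) => //; first by rewrite idealr1.
by move=> x y xp yp; rewrite prime_idealrM negb_or xp.
Qed.

Lemma loc_ring_local (a : A) :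
  (exists b, a * b = 1) \/ (exists b, (1 - a) * b = 1).
Proof.
have inv (c : R) (s : denom p) : c \notin p ->
    exists b, (@Defs.frac R p R^o c s : A) * b = 1.
  move=> cp; exists (@Defs.frac R p R^o (dv s) (Denom cp)).
  rewrite -[LHS]/(loc_mul _ _) loc_mulE; apply: frac_eqr => /=.
  by rewrite mul1r mulr1 mulrC.
have [c [s ->]] := frac_surj a.
have [cp|cp] := boolP (c \in p); last by left; apply: inv.
right; have -> : 1 - (frac c s : A) = @Defs.frac R p R^o (dv s - c) s.
  apply/eqP; rewrite subr_eq; apply/eqP.
  rewrite -[RHS]/(frac _ s + frac _ s) (@frac_addl R^o) subrK.
  by apply: frac_eqr => /=; ring.
apply: inv; apply/negP => scp; have := denomP s.
by rewrite -(subrK c (dv s)) rpredD.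
Qed.

Lemma loc_map V W (f : {linear V -> W}) :
  exists fp : {linear localization p V -> localization p W},
    forall v s, fp (frac v s) = frac (f v) s.
Proof.
have [g gE] : exists g : localization p V -> localization p W,
    forall v s, g (frac v s) = frac (f v) s.
  exists (fun z => frac (f (loc_num z)) (loc_den z)) => v s.
  have /fracP[u e] := frac_numden (frac v s).
  by apply/fracP; exists u; rewrite -!linearZ_LR e.
have lg : linear g.
  move=> a x y; have [c [e ->]] := frac_surj a.
  have [v [s ->]] := frac_surj x; have [w [t ->]] := frac_surj y.
  rewrite -![_ *: _]/(loc_scale _ _) (gE v s) (gE w t) !loc_scaleE !fracD gE.
  by rewrite (linearD f) !(linearZ_LR f).
by exists (mklin lg).
Qed.

(** Once [s] is inverted, the factorization makes the localization a retract of a free module over a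
    local ring. *)
Lemma free_of_factors M s : factors s M -> s \notin p ->
  free_fin_rank (localization p M : lmodType A).
Proof.
move=> [P [f0 [g0 [/fg_projP[n [i [r ri]]] fg0]]]] sp.
pose f : {linear M -> 'rV[R]_n} := i \o f0.
pose g : {linear 'rV[R]_n -> M} := g0 \o r.
have fg x : g (f x) = s *: x by rewrite -fg0 /= ri.
have lf j : linear (fun x => f x 0 j : R^o).
  by move=> a x y; rewrite linearP !mxE.
pose F j := sval (cid (loc_map (mklin (lf j)))).
have FE j v d : F j (frac v d) = @Defs.frac R p R^o (f v 0 j) d.
  by rewrite /F; case: cid => /= ? ->.
have lF : linear (fun z => \row_j (F j z : A)).
  by move=> a x y; apply/rowP => j; rewrite !mxE linearP.
pose G : {linear 'rV[A]_n -> localization p M} :=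
  row_lin (fun j => frac (g (delta_mx 0 j)) (Denom sp)).
apply: (retract_row_free loc_ring_local (i := mklin lF) (p := G)) => z.
have [v [d ->]] := frac_surj z; rewrite row_linE.
transitivity (\sum_j frac (f v 0 j *: g (delta_mx 0 j)) (denomM d (Denom sp))).
  apply: eq_bigr => j _; rewrite mxE /= FE.
  by rewrite -[LHS]/(loc_scale _ _) loc_scaleE.
rewrite frac_suml -linear_rowE fg; apply: frac_eq => /=.
by rewrite scalerA.
Qed.

(** Denominators are cleared from a local isomorphism and its inverse: [y] holds numerators of the
    basis elements, and [c] those of the coordinates of generators of [M]. *)
Lemma factors_of_free M : noetherian R -> fin_gen M ->
  free_fin_rank (localization p M : lmodType A) ->
  exists2 s, s \notin p & factors s M.
Proof.
move=> noethR fM [n [phi [psi phiK psiK]]].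
have lpsi : linear psi.
  by move=> a x y; apply: (can_inj phiK); rewrite linearP !psiK.
have psiE x : psi x = \sum_j x 0 j *: psi (delta_mx 0 j) :=
  linear_rowE (mklin lpsi) x.
have [a [N [i [e sie]]]] := cover_exists fM; have [ii ei se] := sie.
have fN : fin_gen N := noeth_row noethR ii.
have [b [q sq]] := (fin_genP N).1 fN.
pose g k := e (delta_mx 0 k).
have [s sp /(_ _)/cid sP] : exists2 s, s \notin p &
    forall j : 'I_n, exists y, scal_of s *: psi (delta_mx 0 j) = loc_of y.
  apply: (common_denom (P := fun j s => exists y,
    scal_of s *: psi (delta_mx 0 j) = loc_of y)) => [j c d [y yE]|j].
    by exists (d *: y); rewrite scal_ofM -scalerA yE scal_frac.
  exact: clear_denom.
pose y j := sval (sP j).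
have yE j : scal_of s *: psi (delta_mx 0 j) = loc_of (y j) := svalP (sP j).
have [r rp /(_ _)/cid rP] : exists2 r, r \notin p &
    forall kj : 'I_a * 'I_n, exists c,
      scal_of r * phi (loc_of (g kj.1)) 0 kj.2 = scal_of c.
  apply: (common_denom (P := fun (kj : 'I_a * 'I_n) r => exists c,
    scal_of r * phi (loc_of (g kj.1)) 0 kj.2 = scal_of c)) =>
      [kj c d [z zE]|kj].
    by exists (d * z); rewrite scal_ofM -mulrA zE scal_ofM.
  exact: (@clear_denom R^o).
pose c k j : R := sval (rP (k, j)).
have cE k j : scal_of r * phi (loc_of (g k)) 0 j = scal_of (c k j) :=
  svalP (rP (k, j)).
(* The generators are recovered from their coordinates only locally, hence up to a further
   denominator [u]. *)
have [u up uP] : exists2 u, u \notin p &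
    forall k : 'I_a, u *: ((s * r) *: g k) = u *: \sum_j c k j *: y j.
  apply: (common_denom (P :=
    fun k u => u *: ((s * r) *: g k) = u *: \sum_j c k j *: y j)).
    by move=> k v w e1; rewrite -!(scalerA w) e1.
  move=> k; apply/loc_of_eq; rewrite /loc_of -scal_frac -/(loc_of (g k)).
  rewrite -[in LHS](phiK (loc_of (g k))) psiE.
  rewrite -frac_suml scaler_sumr; apply: eq_bigr => j _.
  rewrite -scal_frac -/(loc_of (y j)) -yE -cE !scalerA scal_ofM.
  by congr (_ *: _); rewrite -mulrA mulrC.
(* Likewise the coordinates [c] respect the relations of [M] only after multiplication by some
   [w]. *)
have [w wp wP] : exists2 w, w \notin p & forall lj : 'I_b * 'I_n,
    w * \sum_k i (q (delta_mx 0 lj.1)) 0 k * c k lj.2 = 0.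
  apply: (common_denom (P :=
    fun lj w => w * \sum_k i (q (delta_mx 0 lj.1)) 0 k * c k lj.2 = 0)).
    by move=> lj v w e1; rewrite -mulrA e1 mulr0.
  move=> [l j] /=; set x := i _.
  have : scal_of (\sum_k x 0 k * c k j) = scal_of 0.
    transitivity (scal_of r * phi (loc_of (e x)) 0 j).
      rewrite linear_rowE /loc_of -frac_suml linear_sum summxE mulr_sumr
        scal_of_sum.
      apply: eq_bigr => k _; rewrite -scal_frac linearZ_LR mxE scal_ofM -cE.
      by rewrite mulrCA.
    rewrite (ses0 _ sie) (_ : loc_of 0 = 0) ?linear0 ?mxE ?mulr0 //.
  move=> /(@loc_of_eq R^o)[w wp wE]; exists w => //.
  by rewrite -[LHS]/(w *: (_ : R^o)) wE scaler0.
pose f0 : {linear _ -> 'rV[R]_n} :=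
  row_lin (fun k : 'I_a => \row_j (w * c k j)).
have [|f fE] := linear_factor (f := f0) se.
  move=> _ /ei[x <-]; have [z <-] := sq x.
  rewrite -[LHS]/((f0 \o i \o q) z) linear_rowE; apply: big1 => l _.
  rewrite [X in _ *: X](_ : _ = 0) ?scaler0 //.
  rewrite -[LHS]/(f0 (i (q _))) /f0 row_linE; apply/rowP => j.
  rewrite summxE mxE -[RHS](wP (l, j)) mulr_sumr.
  by apply: eq_bigr => k _; rewrite !mxE mulrCA.
exists (w * u * (s * r)).
  by rewrite !prime_idealrM !negb_or wp up sp rp.
exists 'rV[R]_n, f, (u \*: row_lin y); split=> [|x]; first exact: fg_proj_row.
have [z <-] := se x; rewrite fE.
apply: (linear_row_ext (f := (u \*: row_lin y) \o f0)
  (g := (w * u * (s * r)) \*: e)) => k.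
rewrite -[LHS]/(u *: row_lin y
  (row_lin _ (delta_mx 0 k))) row_lin_delta row_linE.
rewrite -[RHS]/((w * u * (s * r)) *: g k) -!mulrA -(scalerA w) -(scalerA u) uP.
rewrite scalerA [w * u]mulrC -scalerA; congr (_ *: _).
rewrite scaler_sumr; apply: eq_bigr => j _.
by rewrite mxE scalerA.
Qed.

End Localize.

(** * Local freeness on the punctured spectrum *)

Section Punctured.
Variables (R : comNzRingType) (m : idealr R).
Hypotheses (noethR : noetherian R) (localR : local_ring m).
Implicit Types M : lmodType R.

Lemma submodule_factors M : @submodule R R^o (fun a => factors a M).
Proof.
split=> [|a x y].
  by exists 'rV[R]_0, \0, \0; split;
    [exact: fg_proj_row|move=> x; rewrite scale0r].
move=> /(factorsM a)[P [f [g [fP fg]]]] [Q [f' [g' [fQ fg']]]].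
exists (P * Q)%type, (pairl f f'), (copair g g'); split=> [|v].
  exact: fg_proj_prod.
by rewrite copairE /= fg fg' -scalerDl.
Qed.

(** The scalars that factor on [M] form an ideal. If it misses all powers of [x], some prime
    contains it but not [x], while freeness there provides such a scalar outside the prime.
    Conversely, a prime other than [m] misses some [x] in [m]. *)
Lemma locally_free_puncturedP M : fin_gen M ->
  locally_free_punctured m M <-> stably_torsion m M.
Proof.
move=> fM; split=> [lf x xm|st p pm].
  apply: contrapT => nx.
  have [|p [Jp xp]] := prime_avoiding noethR (submodule_factors M) (x := x).
    by move=> k fk; apply: nx; exists k.
  have pm : ~ (p =i m) by move=> e; rewrite e xm in xp.
  have [s sp fs] := factors_of_free noethR fM (lf p pm).
  by rewrite (Jp s fs) in sp.
have sub x : x \in p -> x \in m.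
  move=> xp; apply: contrapT => /negP/(local_unit noethR localR)[y xy].
  by have := idealMr y xp; rewrite mulrC xy idealr1.
have [x xm xp] : exists2 x, x \in m & x \notin p.
  apply: contrapT => nx; apply: pm => x; apply/idP/idP => [/sub //|xm].
  by apply: contrapT => /negP xp; apply: nx; exists x.
have [s fs] := st x xm; apply: free_of_factors fs _.
elim: s => [|s IHs]; first by rewrite idealr1.
by rewrite exprS prime_idealrM negb_or xp.
Qed.

Lemma PD0nP n M : PD0n m n M <-> fpdt m n M.
Proof.
split=> [[fM /pd_leP pM /(locally_free_puncturedP fM)]|[pM tM]] //.
have fM := pdl_fin_gen pM; split=> //; first exact/pd_leP.
exact/locally_free_puncturedP.
Qed.

End Punctured.

(** * The resolution of the residue field and its dual *)

Section ResidueResolution.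
Variables (R : comNzRingType) (m : idealr R).
Hypothesis noethR : noetherian R.
Hypothesis unit_notin : forall x, x \notin m -> exists y, x * y = 1.
Implicit Types (K M N P T U V W : lmodType R).

(* [A] is the [j]-th differential of a free resolution of [R / m] by row vectors
   that starts with [R]. *)
Fixpoint res_diff (j : nat) a b (A : 'M[R]_(a, b)) : Prop :=
  if j is j'.+1 then
    exists c (B : 'M[R]_(b, c)),
      (forall v : 'rV_b, v *m B = 0 <-> exists w, v = w *m A) /\ res_diff j' B
  else b = 1%N /\ forall v : 'rV_b, (exists w, v = w *m A) <-> forall i,
    v 0 i \in m.

Lemma rows_factor a b n (A : 'M[R]_(a, b)) (X : 'M[R]_(n, b)) :
  (forall i, exists w, row i X = w *m A) -> exists S, X = S *m A.
Proof.
move=> XA; pose w i := sval (cid (XA i)); exists (\matrix_i w i).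
by apply/row_matrixP => i; rewrite row_mul rowK; apply: (svalP (cid (XA i))).
Qed.

Lemma res_diff0_homotopy a b (A : 'M[R]_(a, b)) x :
  res_diff 0 A -> x \in m -> exists S, x%:M = S *m A.
Proof.
move=> [_ imA] xm; apply: rows_factor => i; apply/imA => j; rewrite !mxE.
by case: eqP => _; rewrite ?mulr1n ?mulr0n ?rpred0.
Qed.

(* [x A = A S A] is what we keep of a null homotopy of multiplication by [x]. *)
Lemma res_diff_homotopy j a b (A : 'M[R]_(a, b)) x :
  res_diff j A -> x \in m -> exists S, x *: A = A *m S *m A.
Proof.
move=> + xm; elim: j a b A => [|j IHj] a b A.
  move=> /res_diff0_homotopy/(_ xm)[S xS]; exists S.
  by rewrite -mulmxA -xS mul_mx_scalar.
move=> [c [B [ex rB]]]; have [S' xB] := IHj _ _ B rB.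
(* The matrix [x - B S'] times [B] is 0, so its rows come from [A] by exactness. *)
have [S xS] : exists S, x%:M - B *m S' = S *m A.
  apply: rows_factor => i; apply/ex.
  by rewrite -row_mul mulmxBl mul_scalar_mx xB subrr row0.
exists S; have AB : A *m B = 0.
  apply/row_matrixP => i; rewrite row_mul row0; apply/ex.
  by exists (delta_mx 0 i); rewrite rowE.
by rewrite -mulmxA -xS mulmxBr mul_mx_scalar mulmxA AB mul0mx subr0.
Qed.

Lemma fg_proj_col n : fg_proj 'cV[R]_n.
Proof.
have l1 : linear (fun x : 'cV[R]_n => x^T) by move=> a x y; rewrite linearP.
have l2 : linear (fun x : 'rV[R]_n => x^T) by move=> a x y; rewrite linearP.
apply: (fg_proj_retract (i := mklin l1) (p := mklin l2)) (fg_proj_row R n).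
exact: trmxK.
Qed.

Variable s : seq R.
Hypotheses (reg_s : regular_seq s) (sm : {subset s <= m}).

Lemma span_mod_mulmx r a b (A : 'M[R]_(a, b)) (u : 'cV_b) :
  span_mod r u -> span_mod r (A *m u).
Proof.
have lA : linear (mulmx A : 'cV_b -> 'cV_a) by move=> c x y; rewrite linearP.
exact: (span_mod_map (mklin lA)).
Qed.

(** Multiplication by [s_l] is [S A], so it sends [u] to 0 modulo the earlier elements, where [s_l]
    is regular. *)
Lemma res_diff_col0 a b (A : 'M[R]_(a, b)) l (u : 'cV_b) :
  res_diff 0 A -> (l < size s)%N -> span_mod (take l s) (A *m u) ->
  span_mod (take l s) u.
Proof.
move=> rA ls sAu; apply: (regular_proj reg_s ls (fg_proj_col b)).
have [S xS] := res_diff0_homotopy rA (sm (mem_nth 0 ls)).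
by rewrite -mul_scalar_mx xS -mulmxA; apply: span_mod_mulmx.
Qed.

(* [Ext^i(R/m, R/(s_0, ..., s_(l-1))) = 0] for [0 < i], [l + i < size s]. *)
Lemma res_diff_col j a b c (A : 'M[R]_(a, b)) (B : 'M[R]_(b, c)) l (u : 'cV_b) :
  (forall v : 'rV_b, v *m B = 0 <-> exists w, v = w *m A) -> res_diff j B ->
  (l + j.+1 < size s)%N -> span_mod (take l s) (A *m u) ->
  exists w, span_mod (take l s) (u - B *m w).
Proof.
elim: j a b c A B l u => [|j IHj] a b c A B l u ex rB ls sAu;
  have ls1 : (l < size s)%N by apply: leq_ltn_trans ls; apply: leq_addr.
all: pose x := s`_l; have xm : x \in m by apply: sm; apply: mem_nth.
all: have S V := submodule_span_mod (take l s) V.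
all: have [S' xB] := res_diff_homotopy rB xm.
all: have [S2 xS] : exists S2, x%:M - B *m S' = S2 *m A by
  apply: rows_factor => i; apply/ex;
  rewrite -row_mul mulmxBl mul_scalar_mx xB subrr row0.
(* Modulo the first [l] elements [x u] is [B (S' u)], so the latter vanishes modulo one element
   more. *)
all: have sxu : span_mod (take l s) (x *: u - B *m (S' *m u)) by
  rewrite -mul_scalar_mx mulmxA -mulmxBl xS -mulmxA; apply: span_mod_mulmx.
all: have sBu : span_mod (take l.+1 s) (B *m (S' *m u)) by
  rewrite (take_nth 0) //; apply/span_mod_rcons; exists u;
  rewrite -opprB -scaleN1r; apply: submoduleZ.
(* It then follows that [x (u - B w)] vanishes modulo the first [l] elements, and [x] cancels. *)
all: suff [w sw] : exists w,
  span_mod (take l s) (B *m (S' *m u) - x *: (B *m w)) by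
  exists w; apply: (regular_proj reg_s ls1 (fg_proj_col b));
  rewrite scalerBr -[x *: u](subrK (B *m (S' *m u))) -addrA; apply: submoduleD.
  rewrite addn1 in ls; have := res_diff_col0 rB ls sBu.
  rewrite (take_nth 0) // => /span_mod_rcons[w sw]; exists w.
  by rewrite scalemxAr -mulmxBr; apply: span_mod_mulmx.
have [d [C [exC rC]]] := rB.
(* The induction writes [S' u] as [C u2 + x w] modulo the first [l] elements, and [B C = 0]. *)
have [|u2] := IHj _ _ _ B C l.+1 (S' *m u) exC rC _ sBu;
  first by rewrite addSnnS.
rewrite (take_nth 0) // => /span_mod_rcons[w sw]; exists w.
have BC : B *m C = 0.
  apply/row_matrixP => i; rewrite row_mul row0; apply/exC.
  by exists (delta_mx 0 i); rewrite rowE.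
have := span_mod_mulmx B sw; rewrite !mulmxBr (mulmxA B C) BC mul0mx subr0.
by rewrite scalemxAr.
Qed.

Lemma res_diff_inj a b (A : 'M[R]_(a, b)) (u : 'cV_b) :
  (0 < size s)%N -> res_diff 0 A -> A *m u = 0 -> u = 0.
Proof.
move=> s0 rA Au; apply/span_mod_nil; rewrite -(take0 s).
by apply: (res_diff_col0 rA s0); rewrite take0 Au; apply/span_mod_nil.
Qed.

Lemma res_diff_ker j a b c (A : 'M[R]_(a, b)) (B : 'M[R]_(b, c)) (u : 'cV_b) :
  (forall v : 'rV_b, v *m B = 0 <-> exists w, v = w *m A) -> res_diff j B ->
  (j.+1 < size s)%N -> A *m u = 0 -> exists w, u = B *m w.
Proof.
move=> ex rB ls Au; have [|w] := res_diff_col (l := 0) ex rB ls (u := u).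
  by rewrite take0 Au; apply/span_mod_nil.
by rewrite take0 => /span_mod_nil/eqP; rewrite subr_eq0 => /eqP; exists w.
Qed.

(** Exactness of the dual complex, from [res_diff_ker], identifies [T'] with the cokernel of [B^T].
    Forms on [T'] are rows killed by [B], and these extend because the resolution itself is
    exact. *)
Lemma res_diff_cosyz j a b (A : 'M[R]_(a, b)) T (q : {linear 'rV[R]_a -> T}) :
  res_diff j A -> (j < size s)%N -> surjective q ->
  (forall w, q w = 0 <-> exists v, w = v *m A^T) -> cosyz m j T.
Proof.
elim: j a b A T q => [|j IHj] a b A T q.
  move=> rA js sq eq; have [b1 imA] := rA; subst b.
  have li : linear (fun c : R^o => (c : R)%:M *m A^T : 'rV_a).
    move=> c x y; rewrite -[_ *: x]/((c : R) * x) -mul_scalar_mx mulmxA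
      -scalar_mxM.
    by rewrite -mulmxDl -raddfD.
  have E (v : 'rV[R]_1) : v = (v 0 0)%:M by rewrite -mx11_scalar.
  exists 'rV[R]_a, (mklin li), q; split; first exact: fg_proj_row.
    split=> // [|w].
      apply: linear_inj => c /(congr1 trmx);
        rewrite trmx_mul trmxK trmx0 tr_scalar_mx.
      move=> /(res_diff_inj js rA)/matrixP/(_ 0 0).
      by rewrite !mxE eqxx.
    split=> [/eq[v ->]|[c <-]]; first by exists (v 0 0); rewrite /= -E.
    by apply/eq; exists (c : R)%:M.
  have vE (v : {linear 'rV[R]_a -> R^o}) :
      v (1%:M *m A^T) = ((\row_i (v (delta_mx 0 i) : R)) *m A) 0 0.
    rewrite mul1mx linear_rowE !mxE; apply: eq_bigr => i _.
    by rewrite !mxE [LHS]mulrC.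
  (* Forms on the free module restrict to [R] as the elements of the image of [A], which is [m]. *)
  move=> c; split=> [[v <-]|cm].
    by rewrite /= vE; apply: (imA _).1; exists (\row_i (v (delta_mx 0 i) : R)).
  have [w wE] : exists w, c%:M = w *m A.
    by apply/imA => i; rewrite mxE ord1 eqxx.
  have lw : linear (fun x : 'rV[R]_a => (x *m w^T) 0 0 : R^o).
    by move=> d x y; rewrite mulmxDl -scalemxAl !mxE.
  exists (mklin lw); rewrite /= mul1mx -trmx_mul -wE tr_scalar_mx mxE eqxx //.
move=> [c [B [ex rB]]] js sq eq.
have [T' [i [ii ei]]] := ker_exists q.
have lA : linear (fun v : 'rV[R]_b => v *m A^T).
  by move=> d x y; rewrite mulmxDl -scalemxAl.
have [|q' q'E] := linear_lift (f := mklin lA) ii.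
  by move=> w; apply/ei/eq; exists w.
have sq' : surjective q'.
  move=> y; have /eq[v vE] : q (i y) = 0 by apply/ei; exists y.
  by exists v; apply: ii; rewrite q'E vE.
exists T', 'rV[R]_a, i, q; split=> //; first exact: fg_proj_row.
- move=> u; pose g : 'rV[R]_b := \row_k (u (q' (delta_mx 0 k)) : R).
  have gE v : u (q' v) = (v *m g^T) 0 0.
    rewrite -[LHS]/((u \o q') v) linear_rowE !mxE; apply: eq_bigr => k _.
    by rewrite !mxE.
  have BA : B^T *m A^T = 0.
    rewrite -trmx_mul (_ : A *m B = 0) ?trmx0 //.
    apply/row_matrixP => k; rewrite row_mul row0; apply/ex.
    by exists (delta_mx 0 k); rewrite rowE.
  have [w wE] : exists w, g = w *m A.
    apply/ex; apply: trmx_inj; rewrite trmx0 trmx_mul.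
    apply/row_matrixP => k; rewrite row0 rowE mulmxA; apply/matrixP => x y.
    rewrite !ord1 -gE mxE (_ : q' _ = 0) ?linear0 //; apply: ii.
    by rewrite q'E /= -mulmxA BA mulmx0 linear0.
  have lw : linear (fun x : 'rV[R]_a => (x *m w^T) 0 0 : R^o).
    by move=> d x y; rewrite mulmxDl -scalemxAl !mxE.
  exists (mklin lw) => y; have [v <-] := sq' y.
  by rewrite gE wE trmx_mul mulmxA q'E.
- apply: (IHj _ _ B T' q') => // [|v]; first exact: ltnW.
  split=> [qv|[z ->]]; last first.
    apply: ii; rewrite q'E /= linear0 -mulmxA.
    rewrite -trmx_mul (_ : A *m B = 0) ?trmx0 ?mulmx0 //.
    apply/row_matrixP => k; rewrite row_mul row0; apply/ex.
    by exists (delta_mx 0 k); rewrite rowE.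
  have Av : A *m v^T = 0.
    by apply: trmx_inj; rewrite trmx_mul trmxK trmx0 -[LHS]q'E qv linear0.
  have [w wE] := res_diff_ker ex rB js Av.
  by exists w^T; rewrite -trmx_mul -wE trmxK.
Qed.

Lemma res_diff_eq j a a' b (A : 'M[R]_(a, b)) (A' : 'M[R]_(a', b)) :
  (forall v : 'rV_b, (exists w, v = w *m A) <-> exists w, v = w *m A') ->
  res_diff j A -> res_diff j A'.
Proof.
case: j => [|j] e /=; first by move=> [b1 imA]; split=> // v; rewrite -e.
by move=> [c [B [ex rB]]]; exists c, B; split=> // v; rewrite ex.
Qed.

(** The cover of the previous kernel is left out because its target depends on the previous step;
    without it the steps can be iterated. *)
Record res_step := ResStep {
  step_rank : nat;
  step_ker : lmodType R;
  step_incl : {linear step_ker -> 'rV[R]_step_rank};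
  step_inj : injective step_incl;
  step_min : forall x j, step_incl x 0 j \in m
}.

Lemma minimal_res_exists M : fin_gen M ->
  exists F : free_complex M, minimal_resolution m F.
Proof.
move=> fM.
have step N : fin_gen N -> exists (s' : res_step)
    (p : {linear 'rV[R]_(step_rank s') -> N}), ses (step_incl s') p.
  move=> /(minimal_cover unit_notin)[n [K [i [p [sip im]]]]].
  have [ii _ _] := sip; by exists (ResStep ii im), p.
have [s0 [p0 sp0]] := step M fM.
have nxt (s1 : res_step) : exists (s' : res_step)
    (p : {linear 'rV[R]_(step_rank s') -> step_ker s1}), ses (step_incl s') p.
  by apply: step; apply: (noeth_row noethR) (@step_inj s1).
pose f s1 := sval (cid (nxt s1)).
have fP s1 := svalP (cid (nxt s1)).
pose p s1 : {linear 'rV[R]_(step_rank (f s1)) -> step_ker s1} :=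
  sval (cid (fP s1)).
have pP s1 : ses (step_incl (f s1)) (p s1) := svalP (cid (fP s1)).
pose st i := iter i f s0.
pose d i : {linear 'rV[R]_(step_rank (st i.+1)) -> 'rV[R]_(step_rank (st i))} :=
  step_incl (st i) \o p (st i).
exists (@FreeComplex R M (fun i => step_rank (st i)) d p0); split=> /=.
- by case: sp0.
- move=> y; have [_ e _] := sp0; rewrite e; have [_ _ sq] := pP s0.
  by split=> [[x <-]|[x <-]]; [have [z <-] := sq x; exists z|exists (p s0 x)].
- move=> i y; have [_ e _] := pP (st i); have [_ _ sq] := pP (st i.+1).
  split=> [|[x <-]].
    rewrite /d /= -(linear0 (step_incl (st i))) => /step_inj/e[x <-].
    by have [z <-] := sq x; exists z.
  rewrite /d /= (_ : p (st i) _ = 0) ?linear0 //; apply/e.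
  by exists (p (st i.+1) x).
- by move=> i x j; apply: step_min.
Qed.

Lemma min_resP M : fin_gen M -> minimal_resolution m (min_res m M).
Proof.
move=> /minimal_res_exists ex; rewrite /min_res.
by case: pselect => // e; apply: (svalP (cid e)).
Qed.

Definition mx_of a b (f : {linear 'rV[R]_a -> 'rV[R]_b}) : 'M[R]_(a, b) :=
  lin1_mx f.

Lemma mx_ofE a b (f : {linear 'rV[R]_a -> 'rV[R]_b}) x : x *m mx_of f = f x.
Proof. exact: mul_rV_lin1. Qed.

(** A row [w] is identified with the form sending [x] to [x w^T]; the dual differential becomes
    multiplication by the transposed matrix. *)
Lemma transpose_cosyz j M : res_diff j (mx_of (fc_diff (min_res m M) 0)) ->
  (j < size s)%N -> cosyz m j (transpose m M).
Proof.
rewrite /transpose; move: (fc_diff _ 0);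
  move: (fc_rank _ 0) (fc_rank _ 1) => b a.
move=> d rd js; have [q [sq eq]] := coker_piP (dual_map d).
have lf n (w : 'rV[R]_n) : linear (fun x : 'rV[R]_n => (x *m w^T) 0 0 : R^o).
  by move=> c x y; rewrite mulmxDl -scalemxAl !mxE.
pose phi n (w : 'rV[R]_n) : dual 'rV[R]_n := form_dual (mklin (lf n w)).
have phiE n (w : 'rV[R]_n) x : dual_form (phi n w) x = (x *m w^T) 0 0 by [].
have lphi n : linear (phi n).
  move=> c x y; apply: dual_ext => z; rewrite dual_formP !phiE.
  by rewrite linearP mulmxDr -scalemxAr !mxE.
have sphi n h : exists w, phi n w = h.
  exists (\row_i (dual_form h (delta_mx 0 i) : R)); apply: dual_ext => x.
  rewrite phiE [RHS]linear_rowE mxE; apply: eq_bigr => i _; by rewrite !mxE.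
have iphi n (w : 'rV[R]_n) (w' : 'rV[R]_n) :
    (forall x : 'rV_n, (x *m w^T) 0 0 = (x *m w'^T) 0 0) -> w = w'.
  move=> e; apply/rowP => i; have := e (delta_mx 0 i).
  by rewrite -!rowE !mxE.
apply: (res_diff_cosyz (q := q \o mklin (lphi a))) rd js _ _.
  by move=> y; have [h <-] := sq y; have [w <-] := sphi a h; exists w.
move=> w; rewrite /= eq; split=> [[h hE]|[v ->]].
  have [v vh] := sphi b h; exists v; apply: iphi => x.
  rewrite -phiE -hE -vh trmx_mul trmxK mulmxA mx_ofE //.
exists (phi b v); apply: dual_ext => x.
rewrite phiE trmx_mul trmxK mulmxA mx_ofE //.
Qed.

Lemma residue_piP : exists pi : {linear R^o -> residue_field m},
  surjective pi /\ forall x, pi x = 0 <-> x \in m.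
Proof.
have lq : linear (\pi_(lquot (ideal_submod m))%qT : R^o -> residue_field m).
  by move=> a x y; rewrite lquot_piD lquot_scale_pi.
exists (mklin lq); split=> [y|y]; first by exists (repr y); rewrite /= reprK.
have e : mklin lq y = mklin lq 0 <-> y \in ideal_submod m.
  rewrite -[y in y \in _]subr0.
  by rewrite (@Quotient.idealrBE _ (submod_zmod (ideal_submod m)));
    split=> [/eqP|/eqP].
by rewrite linear0 in e.
Qed.

Lemma fin_gen_residue : fin_gen (residue_field m).
Proof.
have [pi [spi _]] := residue_piP.
exact: fin_gen_surj spi (fg_proj_regular R).1.
Qed.

(** The point is that minimality forces the last free module to have rank 1: rank 0 would make the
    residue field zero, and two basis vectors would satisfy a relation with a unit coefficient. *)
Lemma res_diff_residue j :
  res_diff j (mx_of (fc_diff (min_res m (residue_field m)) j)).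
Proof.
have [se e0 ex dm] := min_resP fin_gen_residue.
elim: j => [|j IHj] /=; last first.
  exists (fc_rank (min_res m (residue_field m)) j),
    (mx_of (fc_diff (min_res m (residue_field m)) j)); split=> // v.
  rewrite mx_ofE ex; split=> -[w]; first by move=> <-; exists w; rewrite mx_ofE.
  by move=> ->; exists w; rewrite mx_ofE.
move: (min_res _ _) se e0 ex dm => F se e0 _ dm.
have [pi [spi pi0]] := residue_piP.
have mk x (y : residue_field m) : x \in m -> x *: y = 0.
  move=> xm; have [r <-] := spi y; rewrite -linearZ_LR; apply/pi0.
  by rewrite -[_ *: _]/(x * r) mulrC idealMr.
split=> [|v]; last first.
  split=> [[w ->] i|vm]; first by rewrite mx_ofE; apply: (dm 0%N).
  have /e0[w wE] : fc_aug F v = 0.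
    by rewrite linear_rowE big1 // => i _; apply: mk.
  by exists w; rewrite mx_ofE.
have om i : fc_aug F (delta_mx 0 i) <> 0.
  move=> /e0[w wE]; have := dm 0%N w i; rewrite wE mxE !eqxx.
  by rewrite idealr1.
have [y yE] := se (pi 1).
case: {-1}(fc_rank F 0) (erefl (fc_rank F 0)) => [|[|n]] // rE.
  have y0 : y = 0 by move: (y); rewrite rE => z; exact: thinmx0.
  have : pi 1 = 0 by rewrite -yE y0 linear0.
  by move=> /pi0; rewrite idealr1.
have [i0 [i1 ne]] : exists i0 i1 : 'I_(fc_rank F 0), i0 != i1.
  by rewrite rE; exists ord0, ord_max.
have [r0 r0E] := spi (fc_aug F (delta_mx 0 i0)).
have [r1 r1E] := spi (fc_aug F (delta_mx 0 i1)).
have /e0[w wE] : fc_aug F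
  ((r1 : R) *: delta_mx 0 i0 - (r0 : R) *: delta_mx 0 i1) = 0.
  rewrite linearB !linearZ_LR -r0E -r1E -!linearZ_LR /=.
  by rewrite [_ *: r1](mulrC (r0 : R)) subrr.
case: (om i1); rewrite -r1E; apply/pi0.
have := dm 0%N w i0; rewrite wE !mxE !eqxx (negPf ne) andbF.
by rewrite mulr1 mulr0 subr0.
Qed.

(** The minimal resolution chosen for the syzygy need not be the truncation of the one for the
    residue field. Its augmentation followed by the inclusion has the same image as [d], however,
    and [res_diff] depends only on images. *)
Lemma cosyz_transpose_syzygy j : (j < size s)%N ->
  cosyz m j (transpose m (syzygy m j (residue_field m))).
Proof.
move=> js; apply: transpose_cosyz (js).
case: j {js} => [|j]; first exact: (res_diff_residue 0%N).
rewrite [syzygy _ _ _]/=.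
set d := fc_diff _ j; have fS : fin_gen (image_mod d).
  have li : linear (@submod_val _ _ (im_pred d)) by [].
  apply: (noeth_row noethR (i := mklin li)) => x y; exact: val_inj.
have [se e0 _ _] := min_resP fS;
  move: (min_res _ (image_mod d)) se e0 => G se e0.
have lv : linear (fun x => submod_val (fc_aug G x)).
  by move=> a x y; rewrite linearP.
exists (fc_rank (min_res m (residue_field m)) j), (mx_of (mklin lv));
  split=> [v|].
  rewrite mx_ofE /=; split=> [v0|[w ->]].
    have /e0[w wE] : fc_aug G v = 0 by apply: val_inj.
    by exists w; rewrite mx_ofE.
  by rewrite mx_ofE (_ : fc_aug G _ = 0) //; apply/e0; exists w.
apply: (res_diff_eq _ (res_diff_residue j)) => v; split=> [[w ->]|[w ->]].
  have dw : d w \in im_pred d by apply/asboolP; exists w.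
  have [x xE] := se (Submod dw); exists x.
  by rewrite !mx_ofE /= xE.
rewrite mx_ofE /=; case: (fc_aug G w) => y /= /asboolP[x <-].
by exists x; rewrite mx_ofE.
Qed.

End ResidueResolution.

(** * The filtration, the classification and the generators *)

Section Main.
Variables (R : comNzRingType) (m : idealr R) (t : nat).
Hypotheses (noethR : noetherian R) (localR : local_ring m)
  (depthR : depth_is m t).
Implicit Types (M : lmodType R) (X : subcat R).

Local Notation k := (residue_field m).
Local Notation T i := (transpose m (syzygy m i k)).

Let unit_notin x : x \notin m -> exists y, x * y = 1.
Proof. exact: local_unit. Qed.

Lemma PD0nE n : PD0n m n = fpdt m n.
Proof. by apply/funext => M; apply/propext; apply: PD0nP. Qed.

Lemma cosyz_transpose i : (i < t)%N -> cosyz m i (T i).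
Proof.
have [[s [reg sm <-]] _] := depthR => it.
exact: (cosyz_transpose_syzygy noethR unit_notin reg sm it).
Qed.

Lemma add_ringP M : add_ring M <-> fpdt m 0 M.
Proof.
split=> [[n Mn]|[/fg_projP[n [i [p pi]]] _]]; last first.
  by exists n; apply/summand_retract; exists i, p.
have fM := fg_proj_summand Mn (fg_proj_row R n).
by split=> // x _; exists 0%N; apply: factors_proj.
Qed.

(** The cosyzygy [T n] has projective dimension exactly [n + 1]. *)
Lemma fpdt_proper n : (n < t)%N -> subcat_proper (fpdt m n) (fpdt m n.+1).
Proof.
move=> nt; split=> [M [pM tM]|sub]; first by split=> //; apply: pdlS.
have cT := cosyz_transpose nt; apply: (cosyz_not_pdl cT).
by have [] := sub _ (cosyz_fpdt cT).
Qed.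

Lemma fpdt_top M : fpdt m t M <-> PD0 m M.
Proof.
rewrite -PD0nE; split=> [[fM pM lM]|[fM [n /pd_leP pM] lM]]; split=> //.
  by exists t.
by apply/pd_leP; apply: (pdl_bound noethR unit_notin depthR pM).
Qed.

(** Here [n] is the least bound for the projective dimensions in [X]; if positive, it is attained by
    a module of [X], to which [fpdt_sub_resolving] applies. *)
Lemma resolving_classification X : resolving X -> subcat_sub X (PD0 m) ->
  exists2 n, (n <= t)%N & subcat_eq X (fpdt m n).
Proof.
move=> rX XPD; have XF M : X M -> fpdt m t M by move=> /XPD/fpdt_top.
have ex : exists n, `[< forall M, X M -> pdl n M >].
  by exists t; apply/asboolP => M /XF[].
case: (ex_minnP ex) => n /asboolP Xn nmin; exists n.
  by apply: nmin; apply/asboolP => M /XF[].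
move=> M; split=> [XM|]; first by split; [exact: Xn|have [] := XF M XM].
have nt : (n <= t)%N by apply: nmin; apply/asboolP => N /XF[].
case: n => [|n] in Xn nmin nt *; first by case=> fM _;
  apply: resolving_proj rX fM.
have [N XN nN] : exists2 N, X N & ~ pdl n N.
  apply: contrapT => nex; suff /nmin : `[< forall N, X N -> pdl n N >].
    by rewrite ltnn.
  by apply/asboolP => N XN; apply: contrapT => nN; apply: nex; exists N.
apply: (fpdt_sub_resolving noethR unit_notin rX _ _ nN XN).
  by move=> j jn; exists (T j); apply: cosyz_transpose;
    apply: leq_ltn_trans jn nt.
by split; [exact: Xn|have [] := XF N XN].
Qed.

(** The cosyzygies of lower degree are successive syzygies of [T n]. They are not known to be the
    modules [T j] themselves, hence the generalization to an arbitrary [T0]. *)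
Lemma fpdt_eq_res n : (n < t)%N -> subcat_eq (fpdt m n.+1) (res (T n)).
Proof.
move=> nt; have cT := cosyz_transpose nt => M; split; last first.
  by apply; [exact: resolving_fpdt|exact: cosyz_fpdt].
move=> fM X rX XT; have [ecX _ sX] := rX.
apply: (fpdt_extension_closed noethR unit_notin ecX) fM.
  exact: resolving_proj rX (fg_proj_regular R).
move: XT cT; move: (transpose m _) => T0;
  elim: n {nt M} T0 => [|n IHn] T0 XT cT j.
  by case: j => // _; exists T0.
rewrite ltnS leq_eqVlt => /orP[/eqP ->|jn]; first by exists T0.
have [T1 [G [i [q [fG s _ cT1]]]]] := cT; apply: (IHn T1) => //.
exact: sX (ses_short s) fG.1 fG.2 XT.
Qed.

Lemma fpdt_eq_ext n : (n < t)%N ->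
  subcat_eq (fpdt m n.+1) (ext (R^o * direct_sum (fun i => T i) n.+1)%type).
Proof.
move=> nt M; have [ecF _ _] := resolving_fpdt m n.+1; split; last first.
  apply=> //; have [_ _ eF] := ecF.
  apply: (eF _ _ _ (ses_short (ses_prod _ _)))
    (resolving_proj _ (fg_proj_regular R)) _.
    exact: resolving_fpdt.
  suff H j : (j <= n.+1)%N ->
    fpdt m n.+1 (direct_sum (fun i => T i) j) by apply: H.
  elim: j => [_|j IHj jn] /=.
    exact: resolving_proj (resolving_fpdt m _) (fg_proj_row R 0).
  apply: eF (ses_short (ses_prod _ _)) (IHj (ltnW jn)) _.
  have [pT tT] := cosyz_fpdt (cosyz_transpose (leq_trans jn nt)).
  by split=> //; apply: pdl_leq pT.
move=> fM X ecX XS; have [_ sX _] := ecX.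
apply: (fpdt_extension_closed noethR unit_notin ecX) fM.
  by apply: sX XS _; apply: summand_prodl.
have {XS} : X (direct_sum (fun i => T i) n.+1).
  by apply: sX XS _; apply: summand_prodr.
have : (n.+1 <= t)%N by [].
elim: n.+1 => // j IHj jt /= XS i; rewrite ltnS leq_eqVlt => /orP[/eqP ->|ij].
  exists (T j); last exact: cosyz_transpose.
  by apply: sX XS _; apply: summand_prodr.
apply: IHj (ltnW jt) _ i ij; apply: sX XS _; exact: summand_prodl.
Qed.

End Main.

Theorem theorem2p1 (R : comNzRingType) (m : idealr R) (t : nat)
    (noethR : noetherian R) (localR : local_ring m) (depthR : depth_is m t) :
  let k := residue_field m in
  [/\ [/\ subcat_eq (@add_ring R) (PD0n m 0),
          forall n : nat, (n < t)%N -> subcat_proper (PD0n m n) (PD0n m n.+1)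
        & subcat_eq (PD0n m t) (PD0 m)],
      forall n : nat, (n <= t)%N -> resolving (PD0n m n),
      forall X : subcat R, resolving X -> subcat_sub X (PD0 m) ->
        exists2 n : nat, (n <= t)%N & subcat_eq X (PD0n m n)
    & forall n : nat, (1 <= n <= t)%N ->
        subcat_eq (PD0n m n) (res (transpose m (syzygy m n.-1 k))) /\
        subcat_eq (res (transpose m (syzygy m n.-1 k)))
          (ext (R^o * direct_sum (fun i => transpose m (syzygy m i k)) n)%type)].
Proof.
move=> k; have E := PD0nE noethR localR.
split; first split.
- by move=> M; rewrite E; apply: add_ringP.
- by move=> n nt; rewrite !E; apply: (fpdt_proper noethR localR depthR nt).
- by move=> M; rewrite E; apply: fpdt_top.
- by move=> n _; rewrite E; apply: resolving_fpdt.
- move=> X rX XPD.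
  have [n nt Xn] := resolving_classification noethR localR depthR rX XPD.
  by exists n => //; rewrite E.
- case=> // n /= nt; rewrite E.
  have r := fpdt_eq_res noethR localR depthR nt.
  have e := fpdt_eq_ext noethR localR depthR nt.
  by split=> // M; rewrite -r e.
Qed.
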